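(* Suppose the EEC computation type $\underline R$ is either a computation-type constant or $\underline I$, and let $(\cdot)^\bullet,(\cdot)^\circ$ be the generic self-translation relative to $\underline R$. For a context $\Gamma=x_1{:}C_1,\ldots,x_n{:}C_n$ write $[\theta^{-1}(\Gamma)]$ for the simultaneous substitution $[\theta_{C_1}^{-1}x_1,\ldots,\theta_{C_n}^{-1}x_n/x_1,\ldots,x_n]$. Then: (1) If $\Gamma\mid-\vdash t:A$, then $\Gamma\mid-\vdash t=(\theta_A\,t^{\bullet\bullet})[\theta^{-1}(\Gamma)]:A$. (2) If $\Gamma\mid z{:}\underline A\vdash t:\underline B$, then $\Gamma\mid z{:}\underline A\vdash t=(\underline\theta_{\underline B}\{t^{\circ\circ}\})[\underline\theta_{\underline A}^{-1}\{z\}/k_{k_z}][\theta^{-1}(\Gamma)]:\underline B$. (Here $t^{\bullet\bullet}=(t^\bullet)^\bullet$, typed $\Gamma^{\bullet\bullet}\mid-\vdash t^{\bullet\bullet}:A^{\bullet\bullet}$, and $t^{\circ\circ}=(t^\circ)^\circ$ is obtained by translating $\Gamma^\bullet\mid k_z{:}\underline B^\circ\vdash t^\circ:\underline A^\circ$, giving $\Gamma^{\bullet\bullet}\mid k_{k_z}{:}\underline A^{\circ\circ}\vdash t^{\circ\circ}:\underline B^{\circ\circ}$.)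
   Context: **EEC (enriched effect calculus).** There are value-type constants $\alpha,\beta,\ldots$ and a disjoint set of computation-type constants $\underline{\alpha},\underline{\beta},\ldots$. Value types $A,B,C$ and computation types $\underline{A},\underline{B},\underline{C},\underline{D}$ are generated by $A::=\alpha\mid 1\mid A\times B\mid A\to B\mid \underline{A}\mid \underline{A}\multimap\underline{B}$ and $\underline{A}::=\underline{\alpha}\mid\underline{1}\mid\underline{A}\,\&\,\underline{B}\mid A\Rightarrow\underline{B}\mid\underline{I}\mid\ !A\mid\ !A\otimes\underline{B}\mid\underline{0}\mid\underline{A}\oplus\underline{B}$ (every computation type is also a value type; $!A\otimes\underline{B}$ is one primitive binary constructor). Judgements are $\Gamma\mid -\vdash t:A$ and $\Gamma\mid z{:}\underline{A}\vdash t:\underline{B}$, where $\Gamma$ lists distinct variables with value types and the ''stoup'' holds at most one variable, of computation type; with nonempty stoup the result type is a computation type. Below $\Delta$ is empty or $z{:}\underline{D}$. Typing rules: $\Gamma,x{:}A\mid-\vdash x:A$; $\Gamma\mid-\vdash *:1$; pairs $\langle t,u\rangle:A\times B$, projections $\pi_1t,\pi_2t$; $\lambda x{:}A.t:A\to B$ from $\Gamma,x{:}A\mid-\vdash t:B$; application $t\,u$ (all with empty stoup). $\Gamma\mid z{:}\underline A\vdash z:\underline A$; $\Gamma\mid\Delta\vdash\underline{*}:\underline 1$; from $\Gamma\mid\Delta\vdash t:\underline A$, $\Gamma\mid\Delta\vdash u:\underline B$ get $\Gamma\mid\Delta\vdash\langle t,u\rangle_c:\underline A\,\&\,\underline B$,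 and from $\Gamma\mid\Delta\vdash t:\underline A\,\&\,\underline B$ get $\underline\pi_1t:\underline A$, $\underline\pi_2t:\underline B$; from $\Gamma,x{:}A\mid\Delta\vdash t:\underline B$ get $\Gamma\mid\Delta\vdash\underline\lambda x{:}A.t:A\Rightarrow\underline B$; from $\Gamma\mid\Delta\vdash s:A\Rightarrow\underline B$, $\Gamma\mid-\vdash t:A$ get $\Gamma\mid\Delta\vdash s@t:\underline B$; $\Gamma\mid-\vdash\top:\underline I$; from $\Gamma\mid\Delta\vdash t:\underline I$, $\Gamma\mid-\vdash u:\underline A$ get $\Gamma\mid\Delta\vdash \mathrm{let}\ \top\ \mathrm{be}\ t\ \mathrm{in}\ u:\underline A$; from $\Gamma\mid-\vdash t:A$ get $\Gamma\mid-\vdash\,!t:\,!A$; from $\Gamma\mid\Delta\vdash t:\,!A$, $\Gamma,x{:}A\mid-\vdash u:\underline B$ get $\Gamma\mid\Delta\vdash\mathrm{let}\ !x\ \mathrm{be}\ t\ \mathrm{in}\ u:\underline B$; from $\Gamma\mid-\vdash t:A$, $\Gamma\mid\Delta\vdash u:\underline B$ get $\Gamma\mid\Delta\vdash\,!t\otimes u:\,!A\otimes\underline B$; from $\Gamma\mid\Delta\vdash s:\,!A\otimes\underline B$, $\Gamma,x{:}A\mid y{:}\underline B\vdash t:\underline C$ get $\Gamma\mid\Delta\vdash\mathrm{let}\ !x\otimes y\ \mathrm{be}\ s\ \mathrm{in}\ t:\underline C$; from $\Gamma\mid\Delta\vdash t:\underline 0$ get $\Gamma\mid\Delta\vdash\mathrm{abort}_{\underline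 A}(t):\underline A$; $\mathrm{inl}\,t:\underline A\oplus\underline B$ from $t:\underline A$ and $\mathrm{inr}\,t$ from $t:\underline B$ (same $\Gamma\mid\Delta$); from $\Gamma\mid\Delta\vdash s:\underline A\oplus\underline B$, $\Gamma\mid x{:}\underline A\vdash t:\underline C$, $\Gamma\mid y{:}\underline B\vdash u:\underline C$ get $\Gamma\mid\Delta\vdash\mathrm{case}\ s\ \mathrm{of}\ (\mathrm{inl}\,x\Rightarrow t\mid\mathrm{inr}\,y\Rightarrow u):\underline C$; from $\Gamma\mid z{:}\underline A\vdash t:\underline B$ get $\Gamma\mid-\vdash\hat\lambda z{:}\underline A.t:\underline A\multimap\underline B$; from $\Gamma\mid-\vdash s:\underline A\multimap\underline B$, $\Gamma\mid\Delta\vdash t:\underline A$ get $\Gamma\mid\Delta\vdash s\{t\}:\underline B$. Equality $\Gamma\mid\Delta\vdash t=u:A$ is the least typed congruence (equivalence, compatible with all term formers, containing $\alpha$-equivalence) containing all well-typed instances of: $t=*$ for $t:1$; $\pi_1\langle t,u\rangle=t$, $\pi_2\langle t,u\rangle=u$, $\langle\pi_1t,\pi_2t\rangle=t$; $(\lambda x.t)u=t[u/x]$, $\lambda x.(t\,x)=t$ ($x$ not free in $t$); $t=\underline*$ for $t:\underline1$; $\underline\pi_1\langle t,u\rangle_c=t$, $\underline\pi_2\langle t,u\rangle_c=u$, $\langle\underline\pi_1t,\underline\pi_2t\rangle_c=t$; $(\underline\lambda x.t)@u=t[u/x]$, $\underline\lambda x.(t@x)=t$ ($x$ not free); $\mathrm{let}\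 \top\ \mathrm{be}\ \top\ \mathrm{in}\ t=t$; $\mathrm{let}\ \top\ \mathrm{be}\ t\ \mathrm{in}\ u[\top/x]=u[t/x]$ for $\Gamma\mid x{:}\underline I\vdash u:\underline A$; $\mathrm{let}\ !x\ \mathrm{be}\ !t\ \mathrm{in}\ u=u[t/x]$; $\mathrm{let}\ !x\ \mathrm{be}\ t\ \mathrm{in}\ u[!x/y]=u[t/y]$ for $\Gamma\mid y{:}\,!A\vdash u:\underline B$; $\mathrm{let}\ !x\otimes y\ \mathrm{be}\ !t\otimes s\ \mathrm{in}\ u=u[t/x,s/y]$; $\mathrm{let}\ !x\otimes y\ \mathrm{be}\ t\ \mathrm{in}\ u[(!x\otimes y)/z]=u[t/z]$ for $\Gamma\mid z{:}\,!A\otimes\underline B\vdash u:\underline C$; $\mathrm{abort}_{\underline A}(t)=u[t/x]$ for $\Gamma\mid x{:}\underline 0\vdash u:\underline A$; $\mathrm{case}\ \mathrm{inl}\,t\ \mathrm{of}\ (\mathrm{inl}\,x\Rightarrow u\mid\mathrm{inr}\,y\Rightarrow u')=u[t/x]$ and symmetrically for $\mathrm{inr}$; $\mathrm{case}\ t\ \mathrm{of}\ (\mathrm{inl}\,x\Rightarrow u[\mathrm{inl}\,x/z]\mid\mathrm{inr}\,y\Rightarrow u[\mathrm{inr}\,y/z])=u[t/z]$ for $\Gamma\mid z{:}\underline A\oplus\underline B\vdash u:\underline C$; $(\hat\lambda x.t)\{u\}=t[u/x]$, $\hat\lambda x.(t\{x\})=t$ ($x$ not free). **Generic self-translation relative to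 a computation type $\underline R$.** Types: $\alpha^\bullet=\alpha$, $1^\bullet=1$, $(A\times B)^\bullet=A^\bullet\times B^\bullet$, $(A\to B)^\bullet=A^\bullet\to B^\bullet$, $\underline A^\bullet=\underline A^\circ\multimap\underline R$ (a computation type viewed as a value type), $(\underline A\multimap\underline B)^\bullet=\underline B^\circ\multimap\underline A^\circ$; $\underline\alpha^\circ=\underline\alpha$ if $\underline\alpha\neq\underline R$ and $\underline\alpha^\circ=\underline I$ if $\underline R$ is the constant $\underline\alpha$; $\underline1^\circ=\underline0$; $(\underline A\,\&\,\underline B)^\circ=\underline A^\circ\oplus\underline B^\circ$; $(A\Rightarrow\underline B)^\circ=\,!(A^\bullet)\otimes\underline B^\circ$; $\underline I^\circ=\underline R$; $(!A)^\circ=A^\bullet\Rightarrow\underline R$; $(!A\otimes\underline B)^\circ=A^\bullet\Rightarrow\underline B^\circ$; $\underline0^\circ=\underline1$; $(\underline A\oplus\underline B)^\circ=\underline A^\circ\,\&\,\underline B^\circ$. For $\Gamma=x_1{:}C_1,\ldots,x_n{:}C_n$, $\Gamma^\bullet=x_1{:}C_1^\bullet,\ldots,x_n{:}C_n^\bullet$. To each variable $z$ is associated a distinct fresh variable $k_z$ (so iterating gives $k_{k_z}$); $k,h,k_x,k_y$ below are fresh bound variables. Terms: a judgement $\Gamma\mid-\vdash t:A$ goes to $\Gamma^\bullet\mid-\vdash t^\bullet:A^\bullet$, and $\Gamma\mid z{:}\underline D\vdash t:\underline B$ goes to $\Gamma^\bullet\mid k_z{:}\underline B^\circ\vdash t^\circ:\underline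 D^\circ$ (contravariantly); type names below refer to the typing rules. Value clauses: $x^\bullet=x$; $*^\bullet=*$; $\langle t,u\rangle^\bullet=\langle t^\bullet,u^\bullet\rangle$; $(\pi_it)^\bullet=\pi_it^\bullet$; $(\lambda x{:}A.t)^\bullet=\lambda x{:}A^\bullet.t^\bullet$; $(t\,u)^\bullet=t^\bullet\,u^\bullet$; $\underline*^\bullet=\hat\lambda k{:}\underline0.\,\mathrm{abort}_{\underline R}(k)$; $\langle t,u\rangle_c^\bullet=\hat\lambda k{:}\underline A^\circ\oplus\underline B^\circ.\,\mathrm{case}\ k\ \mathrm{of}\ (\mathrm{inl}\,k_x\Rightarrow t^\bullet\{k_x\}\mid\mathrm{inr}\,k_y\Rightarrow u^\bullet\{k_y\})$; $(\underline\pi_1t)^\bullet=\hat\lambda k{:}\underline A^\circ.\,t^\bullet\{\mathrm{inl}\,k\}$; $(\underline\pi_2t)^\bullet=\hat\lambda k{:}\underline B^\circ.\,t^\bullet\{\mathrm{inr}\,k\}$; $(\underline\lambda x{:}A.t)^\bullet=\hat\lambda k{:}\,!A^\bullet\otimes\underline B^\circ.\,\mathrm{let}\ !x\otimes h\ \mathrm{be}\ k\ \mathrm{in}\ t^\bullet\{h\}$; $(s@t)^\bullet=\hat\lambda k{:}\underline B^\circ.\,s^\bullet\{!(t^\bullet)\otimes k\}$; $\top^\bullet=\hat\lambda k{:}\underline R.\,k$; $(\mathrm{let}\ \top\ \mathrm{be}\ t\ \mathrm{in}\ u)^\bullet=\hat\lambda k{:}\underline A^\circ.\,t^\bullet\{u^\bullet\{k\}\}$;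 $(!t)^\bullet=\hat\lambda k{:}A^\bullet\Rightarrow\underline R.\,k@t^\bullet$; $(\mathrm{let}\ !x\ \mathrm{be}\ t\ \mathrm{in}\ u)^\bullet=\hat\lambda k{:}\underline B^\circ.\,t^\bullet\{\underline\lambda x{:}A^\bullet.\,u^\bullet\{k\}\}$; $(!t\otimes u)^\bullet=\hat\lambda k{:}A^\bullet\Rightarrow\underline B^\circ.\,u^\bullet\{k@t^\bullet\}$; $(\mathrm{let}\ !x\otimes y\ \mathrm{be}\ s\ \mathrm{in}\ t)^\bullet=\hat\lambda k{:}\underline C^\circ.\,s^\bullet\{\underline\lambda x{:}A^\bullet.\,t^\circ[k/k_y]\}$; $(\mathrm{abort}_{\underline A}(t))^\bullet=\hat\lambda k{:}\underline A^\circ.\,t^\bullet\{\underline*\}$; $(\mathrm{inl}\,t)^\bullet=\hat\lambda k{:}\underline A^\circ\,\&\,\underline B^\circ.\,t^\bullet\{\underline\pi_1k\}$; $(\mathrm{inr}\,t)^\bullet=\hat\lambda k{:}\underline A^\circ\,\&\,\underline B^\circ.\,t^\bullet\{\underline\pi_2k\}$; $(\mathrm{case}\ s\ \mathrm{of}\ (\mathrm{inl}\,x\Rightarrow t\mid\mathrm{inr}\,y\Rightarrow u))^\bullet=\hat\lambda k{:}\underline C^\circ.\,s^\bullet\{\langle t^\circ[k/k_x],u^\circ[k/k_y]\rangle_c\}$; $(\hat\lambda z{:}\underline A.t)^\bullet=\hat\lambda k{:}\underline B^\circ.\,t^\circ[k/k_z]$; $(s\{t\})^\bullet=\hat\lambda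 k{:}\underline B^\circ.\,t^\bullet\{s^\bullet\{k\}\}$. Computation clauses (stoup $z{:}\underline D$): $z^\circ=k_z$; $\underline*^\circ=\mathrm{abort}_{\underline D^\circ}(k_z)$; $\langle t,u\rangle_c^\circ=\mathrm{case}\ k_z\ \mathrm{of}\ (\mathrm{inl}\,k_x\Rightarrow t^\circ[k_x/k_z]\mid\mathrm{inr}\,k_y\Rightarrow u^\circ[k_y/k_z])$; $(\underline\pi_1t)^\circ=t^\circ[\mathrm{inl}\,k_z/k_z]$; $(\underline\pi_2t)^\circ=t^\circ[\mathrm{inr}\,k_z/k_z]$; $(\underline\lambda x{:}A.t)^\circ=\mathrm{let}\ !x\otimes h\ \mathrm{be}\ k_z\ \mathrm{in}\ t^\circ[h/k_z]$; $(s@t)^\circ=s^\circ[(!(t^\bullet)\otimes k_z)/k_z]$; $(\mathrm{let}\ \top\ \mathrm{be}\ t\ \mathrm{in}\ u)^\circ=t^\circ[u^\bullet\{k_z\}/k_z]$; $(\mathrm{let}\ !x\ \mathrm{be}\ t\ \mathrm{in}\ u)^\circ=t^\circ[(\underline\lambda x{:}A^\bullet.\,u^\bullet\{k_z\})/k_z]$; $(!t\otimes u)^\circ=u^\circ[(k_z@t^\bullet)/k_z]$; $(\mathrm{let}\ !x\otimes y\ \mathrm{be}\ s\ \mathrm{in}\ t)^\circ=s^\circ[(\underline\lambda x{:}A^\bullet.\,t^\circ[k_z/k_y])/k_z]$; $(\mathrm{abort}(t))^\circ=t^\circ[\underline*/k_z]$; $(\mathrm{inl}\,t)^\circ=t^\circ[\underline\pi_1k_z/k_z]$;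 $(\mathrm{inr}\,t)^\circ=t^\circ[\underline\pi_2k_z/k_z]$; $(\mathrm{case}\ s\ \mathrm{of}\ (\mathrm{inl}\,x\Rightarrow t\mid\mathrm{inr}\,y\Rightarrow u))^\circ=s^\circ[\langle t^\circ[k_z/k_x],u^\circ[k_z/k_y]\rangle_c/k_z]$; $(s\{t\})^\circ=t^\circ[s^\bullet\{k_z\}/k_z]$. **Isomorphisms $\theta_A:A^{\bullet\bullet}\to A$ and $\underline\theta_{\underline A}:\underline A^{\circ\circ}\multimap\underline A$** (closed terms; when $\underline R$ is a computation-type constant or $\underline I$ each has an inverse $\theta_A^{-1}$, resp. linear inverse $\underline\theta_{\underline A}^{-1}$, unique up to provable equality, and the definition below, by simultaneous induction on types with $\underline\theta_{\underline A}$ before $\theta_{\underline A}$, uses these inverses at smaller types): $\theta_\alpha=\lambda x{:}\alpha.x$; $\theta_1=\lambda x{:}1.*$; $\theta_{A\times B}=\lambda z{:}A^{\bullet\bullet}\times B^{\bullet\bullet}.\langle\theta_A(\pi_1z),\theta_B(\pi_2z)\rangle$; $\theta_{A\to B}=\lambda f{:}A^{\bullet\bullet}\to B^{\bullet\bullet}.\lambda x{:}A.\,\theta_B(f(\theta_A^{-1}x))$; $\theta_{\underline A}=\lambda h{:}\underline I\multimap\underline A^{\circ\circ}.\,\underline\theta_{\underline A}\{h\{\top\}\}$; $\theta_{\underline A\multimap\underline B}=\lambda h{:}\underline A^{\circ\circ}\multimap\underline B^{\circ\circ}.\,\hat\lambda x{:}\underline A.\,\underline\theta_{\underline B}\{h\{\underline\theta_{\underline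 A}^{-1}\{x\}\}\}$; $\underline\theta_{\underline\alpha}=\hat\lambda z{:}\underline\alpha.z$; $\underline\theta_{\underline1}=\hat\lambda z{:}\underline1.\underline*$; $\underline\theta_{\underline A\&\underline B}=\hat\lambda z{:}\underline A^{\circ\circ}\,\&\,\underline B^{\circ\circ}.\langle\underline\theta_{\underline A}\{\underline\pi_1z\},\underline\theta_{\underline B}\{\underline\pi_2z\}\rangle_c$; $\underline\theta_{A\Rightarrow\underline B}=\hat\lambda f{:}A^{\bullet\bullet}\Rightarrow\underline B^{\circ\circ}.\,\underline\lambda x{:}A.\,\underline\theta_{\underline B}\{f@(\theta_A^{-1}x)\}$; $\underline\theta_{\underline I}=\hat\lambda z{:}\underline I.z$; $\underline\theta_{!A}=\hat\lambda z{:}\,!(A^{\bullet\bullet})\otimes\underline I.\,\mathrm{let}\ !x\otimes y\ \mathrm{be}\ z\ \mathrm{in}\ \mathrm{let}\ \top\ \mathrm{be}\ y\ \mathrm{in}\ !(\theta_Ax)$; $\underline\theta_{!A\otimes\underline B}=\hat\lambda z{:}\,!(A^{\bullet\bullet})\otimes\underline B^{\circ\circ}.\,\mathrm{let}\ !x\otimes y\ \mathrm{be}\ z\ \mathrm{in}\ !(\theta_Ax)\otimes(\underline\theta_{\underline B}\{y\})$; $\underline\theta_{\underline0}=\hat\lambda z{:}\underline0.z$; $\underline\theta_{\underline A\oplus\underline B}=\hat\lambda z{:}\underline A^{\circ\circ}\oplus\underline B^{\circ\circ}.\,\mathrm{case}\ z\ \mathrm{of}\ (\mathrm{inl}\,x\Rightarrow\mathrm{inl}(\underline\theta_{\underline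 A}\{x\})\mid\mathrm{inr}\,y\Rightarrow\mathrm{inr}(\underline\theta_{\underline B}\{y\}))$. *)

(* Defs.v *)
From Stdlib Require Import FunctionalExtensionality Setoid Morphisms.
From mathcomp Require Import ssreflect ssrfun ssrbool eqtype seq.

Set Implicit Arguments.
Unset Strict Implicit.
Unset Printing Implicit Defensive.

(* VK and CK are the disjoint sets of value-type and computation-type
   constants. *)
Section Syntax.
Variables (VK : Type) (CK : eqType).

Inductive vty : Type :=
  | VConst (a : VK)
  | VUnit
  | VProd (A B : vty)
  | VArr (A B : vty)
  | VComp (A : cty)
  | VLin (A B : cty)
with cty : Type :=
  | CConst (a : CK)
  | CUnit
  | CProd (A B : cty)
  | CArr (A : vty) (B : cty)
  | CI
  | CBang (A : vty)
  | CTens (A : vty) (B : cty)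
  | CZero
  | CSum (A B : cty).

Definition ctx := seq vty.

Definition stoup := option cty.

(* de Bruijn variables: [var G A] is the type of positions of G holding A. *)
Inductive var : ctx -> vty -> Type :=
  | vz A G : var (A :: G) A
  | vs A B G : var G A -> var (B :: G) A.

(* [tm G D A] is the type of derivations of  G | D |- t : A,  i.e. of
   well-typed terms up to alpha-equivalence in which the types named in the
   typing rules are recorded.  The stoup variable is nameless: it is [tz]. *)
Inductive tm : ctx -> stoup -> vty -> Type :=
  | tvar G A : var G A -> tm G None A
  | tstar G : tm G None VUnit
  | tpair G A B : tm G None A -> tm G None B -> tm G None (VProd A B)
  | tfst G A B : tm G None (VProd A B) -> tm G None A
  | tsnd G A B : tm G None (VProd A B) -> tm G None B
  | tlam G A B : tm (A :: G) None B -> tm G None (VArr A B)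
  | tapp G A B : tm G None (VArr A B) -> tm G None A -> tm G None B
  | tz G A : tm G (Some A) (VComp A)
  | tcstar G D : tm G D (VComp CUnit)
  | tcpair G D A B :
      tm G D (VComp A) -> tm G D (VComp B) -> tm G D (VComp (CProd A B))
  | tcfst G D A B : tm G D (VComp (CProd A B)) -> tm G D (VComp A)
  | tcsnd G D A B : tm G D (VComp (CProd A B)) -> tm G D (VComp B)
  | tclam G D A B : tm (A :: G) D (VComp B) -> tm G D (VComp (CArr A B))
  | tcapp G D A B :
      tm G D (VComp (CArr A B)) -> tm G None A -> tm G D (VComp B)
  | ttop G : tm G None (VComp CI)
  | tlettop G D A :
      tm G D (VComp CI) -> tm G None (VComp A) -> tm G D (VComp A)
  | tbang G A : tm G None A -> tm G None (VComp (CBang A))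
  | tletbang G D A B :
      tm G D (VComp (CBang A)) -> tm (A :: G) None (VComp B) ->
      tm G D (VComp B)
  | ttens G D A B :
      tm G None A -> tm G D (VComp B) -> tm G D (VComp (CTens A B))
  | tlettens G D A B C :
      tm G D (VComp (CTens A B)) -> tm (A :: G) (Some B) (VComp C) ->
      tm G D (VComp C)
  | tabort G D A : tm G D (VComp CZero) -> tm G D (VComp A)
  | tinl G D A B : tm G D (VComp A) -> tm G D (VComp (CSum A B))
  | tinr G D A B : tm G D (VComp B) -> tm G D (VComp (CSum A B))
  | tcase G D A B C :
      tm G D (VComp (CSum A B)) ->
      tm G (Some A) (VComp C) -> tm G (Some B) (VComp C) -> tm G D (VComp C)
  | tllam G A B : tm G (Some A) (VComp B) -> tm G None (VLin A B)
  | tlapp G D A B :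
      tm G None (VLin A B) -> tm G D (VComp A) -> tm G D (VComp B).

Definition renv G G' := forall A, var G A -> var G' A.

Definition rlift G G' A (r : renv G G') : renv (A :: G) (A :: G') :=
  fun B x =>
  match x in var H B return
    match H with
    | [::] => unit
    | A0 :: G0 => renv G0 G' -> var (A0 :: G') B
    end
  with
  | vz A0 G0 => fun _ => vz A0 G'
  | vs B A0 G0 y => fun r => vs A0 (r B y)
  end r.

Fixpoint ren G D A (t : tm G D A) : forall G', renv G G' -> tm G' D A :=
  match t with
  | tvar _ _ x => fun _ r => tvar (r _ x)
  | tstar _ => fun _ _ => tstar _
  | tpair _ _ _ t u => fun _ r => tpair (ren t r) (ren u r)
  | tfst _ _ _ t => fun _ r => tfst (ren t r)
  | tsnd _ _ _ t => fun _ r => tsnd (ren t r)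
  | tlam _ _ _ t => fun _ r => tlam (ren t (rlift r))
  | tapp _ _ _ t u => fun _ r => tapp (ren t r) (ren u r)
  | tz _ _ => fun _ _ => tz _ _
  | tcstar _ _ => fun _ _ => tcstar _ _
  | tcpair _ _ _ _ t u => fun _ r => tcpair (ren t r) (ren u r)
  | tcfst _ _ _ _ t => fun _ r => tcfst (ren t r)
  | tcsnd _ _ _ _ t => fun _ r => tcsnd (ren t r)
  | tclam _ _ _ _ t => fun _ r => tclam (ren t (rlift r))
  | tcapp _ _ _ _ t u => fun _ r => tcapp (ren t r) (ren u r)
  | ttop _ => fun _ _ => ttop _
  | tlettop _ _ _ t u => fun _ r => tlettop (ren t r) (ren u r)
  | tbang _ _ t => fun _ r => tbang (ren t r)
  | tletbang _ _ _ _ t u => fun _ r => tletbang (ren t r) (ren u (rlift r))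
  | ttens _ _ _ _ t u => fun _ r => ttens (ren t r) (ren u r)
  | tlettens _ _ _ _ _ t u => fun _ r => tlettens (ren t r) (ren u (rlift r))
  | tabort _ _ A t => fun _ r => tabort A (ren t r)
  | tinl _ _ _ B t => fun _ r => tinl B (ren t r)
  | tinr _ _ A _ t => fun _ r => tinr A (ren t r)
  | tcase _ _ _ _ _ s t u => fun _ r => tcase (ren s r) (ren t r) (ren u r)
  | tllam _ _ _ t => fun _ r => tllam (ren t r)
  | tlapp _ _ _ _ t u => fun _ r => tlapp (ren t r) (ren u r)
  end.

Definition wk G D A B (t : tm G D A) : tm (B :: G) D A :=
  ren t (fun C x => vs B x).

Definition wk0 G A (t : tm [::] None A) : tm G None A :=
  ren t (fun C x =>
    match x in var H C return
      match H with [::] => var G C | _ :: _ => unit end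
    with vz _ _ => tt | vs _ _ _ _ => tt end).

Definition venv G G' := forall A, var G A -> tm G' None A.

Definition vid G : venv G G := fun A x => tvar x.

Definition scons G G' A (u : tm G' None A) (s : venv G G') :
    venv (A :: G) G' :=
  fun B x =>
  match x in var H B return
    match H with
    | [::] => unit
    | A0 :: G0 => tm G' None A0 -> venv G0 G' -> tm G' None B
    end
  with
  | vz A0 G0 => fun u _ => u
  | vs B A0 G0 y => fun _ s => s B y
  end u s.

Definition vlift G G' A (s : venv G G') : venv (A :: G) (A :: G') :=
  scons (tvar (vz A G')) (fun B x => wk A (s B x)).

(* [senv G D D'] is the type of stoup substitutions: they turn terms with
   stoup D into terms with stoup D'.  A term can be substituted for a stoup
   variable; an empty stoup stays empty. *)
Inductive senv (G : ctx) : stoup -> stoup -> Type :=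
  | senv0 : senv G None None
  | senv1 B D : tm G D (VComp B) -> senv G (Some B) D.

Definition sid G D : senv G D D :=
  match D with
  | None => senv0 G
  | Some A => senv1 (tz G A)
  end.

Definition slift G A D D' (e : senv G D D') : senv (A :: G) D D' :=
  match e with
  | senv0 => senv0 _
  | senv1 _ _ u => senv1 (wk A u)
  end.

Definition sempty G A D (e : senv G None D) (t : tm G None A) : tm G D A :=
  match e in senv _ D0 D return
    match D0 with
    | None => tm G None A -> tm G D A
    | Some _ => unit
    end
  with
  | senv0 => fun t => t
  | senv1 _ _ _ => tt
  end t.

Definition sget G B D (e : senv G (Some B) D) : tm G D (VComp B) :=
  match e in senv _ D0 D return
    match D0 with
    | None => unit
    | Some B => tm G D (VComp B)
    end
  with
  | senv0 => tt
  | senv1 _ _ u => u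
  end.

(* Simultaneous capture-avoiding substitution for all the variables of the
   context and for the stoup variable. *)
Fixpoint sub G D A (t : tm G D A) :
    forall G' D', venv G G' -> senv G' D D' -> tm G' D' A :=
  match t with
  | tvar _ _ x => fun _ _ s e => sempty e (s _ x)
  | tstar _ => fun _ _ s e => sempty e (tstar _)
  | tpair _ _ _ t u => fun _ _ s e =>
      sempty e (tpair (sub t s (senv0 _)) (sub u s (senv0 _)))
  | tfst _ _ _ t => fun _ _ s e => sempty e (tfst (sub t s (senv0 _)))
  | tsnd _ _ _ t => fun _ _ s e => sempty e (tsnd (sub t s (senv0 _)))
  | tlam _ _ _ t => fun _ _ s e =>
      sempty e (tlam (sub t (vlift s) (senv0 _)))
  | tapp _ _ _ t u => fun _ _ s e =>
      sempty e (tapp (sub t s (senv0 _)) (sub u s (senv0 _)))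
  | tz _ _ => fun _ _ s e => sget e
  | tcstar _ _ => fun _ _ s e => tcstar _ _
  | tcpair _ _ _ _ t u => fun _ _ s e => tcpair (sub t s e) (sub u s e)
  | tcfst _ _ _ _ t => fun _ _ s e => tcfst (sub t s e)
  | tcsnd _ _ _ _ t => fun _ _ s e => tcsnd (sub t s e)
  | tclam _ _ _ _ t => fun _ _ s e => tclam (sub t (vlift s) (slift _ e))
  | tcapp _ _ _ _ t u => fun _ _ s e =>
      tcapp (sub t s e) (sub u s (senv0 _))
  | ttop _ => fun _ _ s e => sempty e (ttop _)
  | tlettop _ _ _ t u => fun _ _ s e =>
      tlettop (sub t s e) (sub u s (senv0 _))
  | tbang _ _ t => fun _ _ s e => sempty e (tbang (sub t s (senv0 _)))
  | tletbang _ _ _ _ t u => fun _ _ s e =>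
      tletbang (sub t s e) (sub u (vlift s) (senv0 _))
  | ttens _ _ _ _ t u => fun _ _ s e =>
      ttens (sub t s (senv0 _)) (sub u s e)
  | tlettens _ _ _ _ _ t u => fun _ _ s e =>
      tlettens (sub t s e) (sub u (vlift s) (sid _ _))
  | tabort _ _ A t => fun _ _ s e => tabort A (sub t s e)
  | tinl _ _ _ B t => fun _ _ s e => tinl B (sub t s e)
  | tinr _ _ A _ t => fun _ _ s e => tinr A (sub t s e)
  | tcase _ _ _ _ _ r t u => fun _ _ s e =>
      tcase (sub r s e) (sub t s (sid _ _)) (sub u s (sid _ _))
  | tllam _ _ _ t => fun _ _ s e => sempty e (tllam (sub t s (sid _ _)))
  | tlapp _ _ _ _ t u => fun _ _ s e =>
      tlapp (sub t s (senv0 _)) (sub u s e)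
  end.

Definition vsub G G' D A (t : tm G D A) (s : venv G G') : tm G' D A :=
  sub t s (sid _ _).

(* t[u/x], where x is the last variable of the context of t *)
Definition inst G D A B (t : tm (A :: G) D B) (u : tm G None A) : tm G D B :=
  vsub t (scons u (@vid G)).

(* t[u/z], where z is the stoup variable of t *)
Definition fill G D A B (t : tm G (Some B) A) (u : tm G D (VComp B)) :
    tm G D A :=
  sub t (@vid G) (senv1 u).

(* [eqt t u] is the judgement  G | D |- t = u : A. *)
Inductive eqt : forall G D A, tm G D A -> tm G D A -> Prop :=
  | eqt_refl G D A (t : tm G D A) : eqt t t
  | eqt_sym G D A (t u : tm G D A) : eqt t u -> eqt u t
  | eqt_trans G D A (t u v : tm G D A) : eqt t u -> eqt u v -> eqt t v
  | cong_pair G A B (t t' : tm G None A) (u u' : tm G None B) :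
      eqt t t' -> eqt u u' -> eqt (tpair t u) (tpair t' u')
  | cong_fst G A B (t t' : tm G None (VProd A B)) :
      eqt t t' -> eqt (tfst t) (tfst t')
  | cong_snd G A B (t t' : tm G None (VProd A B)) :
      eqt t t' -> eqt (tsnd t) (tsnd t')
  | cong_lam G A B (t t' : tm (A :: G) None B) :
      eqt t t' -> eqt (tlam t) (tlam t')
  | cong_app G A B (t t' : tm G None (VArr A B)) (u u' : tm G None A) :
      eqt t t' -> eqt u u' -> eqt (tapp t u) (tapp t' u')
  | cong_cpair G D A B (t t' : tm G D (VComp A)) (u u' : tm G D (VComp B)) :
      eqt t t' -> eqt u u' -> eqt (tcpair t u) (tcpair t' u')
  | cong_cfst G D A B (t t' : tm G D (VComp (CProd A B))) :
      eqt t t' -> eqt (tcfst t) (tcfst t')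
  | cong_csnd G D A B (t t' : tm G D (VComp (CProd A B))) :
      eqt t t' -> eqt (tcsnd t) (tcsnd t')
  | cong_clam G D A B (t t' : tm (A :: G) D (VComp B)) :
      eqt t t' -> eqt (tclam t) (tclam t')
  | cong_capp G D A B (t t' : tm G D (VComp (CArr A B)))
      (u u' : tm G None A) :
      eqt t t' -> eqt u u' -> eqt (tcapp t u) (tcapp t' u')
  | cong_lettop G D A (t t' : tm G D (VComp CI))
      (u u' : tm G None (VComp A)) :
      eqt t t' -> eqt u u' -> eqt (tlettop t u) (tlettop t' u')
  | cong_bang G A (t t' : tm G None A) :
      eqt t t' -> eqt (tbang t) (tbang t')
  | cong_letbang G D A B (t t' : tm G D (VComp (CBang A)))
      (u u' : tm (A :: G) None (VComp B)) :
      eqt t t' -> eqt u u' -> eqt (tletbang t u) (tletbang t' u')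
  | cong_tens G D A B (t t' : tm G None A) (u u' : tm G D (VComp B)) :
      eqt t t' -> eqt u u' -> eqt (ttens t u) (ttens t' u')
  | cong_lettens G D A B C (t t' : tm G D (VComp (CTens A B)))
      (u u' : tm (A :: G) (Some B) (VComp C)) :
      eqt t t' -> eqt u u' -> eqt (tlettens t u) (tlettens t' u')
  | cong_abort G D A (t t' : tm G D (VComp CZero)) :
      eqt t t' -> eqt (tabort A t) (tabort A t')
  | cong_inl G D A B (t t' : tm G D (VComp A)) :
      eqt t t' -> eqt (tinl B t) (tinl B t')
  | cong_inr G D A B (t t' : tm G D (VComp B)) :
      eqt t t' -> eqt (tinr A t) (tinr A t')
  | cong_case G D A B C (s s' : tm G D (VComp (CSum A B)))
      (t t' : tm G (Some A) (VComp C)) (u u' : tm G (Some B) (VComp C)) :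
      eqt s s' -> eqt t t' -> eqt u u' -> eqt (tcase s t u) (tcase s' t' u')
  | cong_llam G A B (t t' : tm G (Some A) (VComp B)) :
      eqt t t' -> eqt (tllam t) (tllam t')
  | cong_lapp G D A B (t t' : tm G None (VLin A B)) (u u' : tm G D (VComp A)) :
      eqt t t' -> eqt u u' -> eqt (tlapp t u) (tlapp t' u')
  | eta_star G (t : tm G None VUnit) : eqt t (tstar G)
  | beta_fst G A B (t : tm G None A) (u : tm G None B) :
      eqt (tfst (tpair t u)) t
  | beta_snd G A B (t : tm G None A) (u : tm G None B) :
      eqt (tsnd (tpair t u)) u
  | eta_pair G A B (t : tm G None (VProd A B)) :
      eqt (tpair (tfst t) (tsnd t)) t
  | beta_app G A B (t : tm (A :: G) None B) (u : tm G None A) :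
      eqt (tapp (tlam t) u) (inst t u)
  | eta_lam G A B (t : tm G None (VArr A B)) :
      eqt (tlam (tapp (wk A t) (tvar (vz A G)))) t
  | eta_cstar G D (t : tm G D (VComp CUnit)) : eqt t (tcstar G D)
  | beta_cfst G D A B (t : tm G D (VComp A)) (u : tm G D (VComp B)) :
      eqt (tcfst (tcpair t u)) t
  | beta_csnd G D A B (t : tm G D (VComp A)) (u : tm G D (VComp B)) :
      eqt (tcsnd (tcpair t u)) u
  | eta_cpair G D A B (t : tm G D (VComp (CProd A B))) :
      eqt (tcpair (tcfst t) (tcsnd t)) t
  | beta_capp G D A B (t : tm (A :: G) D (VComp B)) (u : tm G None A) :
      eqt (tcapp (tclam t) u) (inst t u)
  | eta_clam G D A B (t : tm G D (VComp (CArr A B))) :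
      eqt (tclam (tcapp (wk A t) (tvar (vz A G)))) t
  | beta_lettop G A (t : tm G None (VComp A)) : eqt (tlettop (ttop G) t) t
  | eta_lettop G D A (t : tm G D (VComp CI)) (u : tm G (Some CI) (VComp A)) :
      eqt (tlettop t (fill u (ttop G))) (fill u t)
  | beta_letbang G A B (t : tm G None A) (u : tm (A :: G) None (VComp B)) :
      eqt (tletbang (tbang t) u) (inst u t)
  | eta_letbang G D A B (t : tm G D (VComp (CBang A)))
      (u : tm G (Some (CBang A)) (VComp B)) :
      eqt (tletbang t (fill (wk A u) (tbang (tvar (vz A G))))) (fill u t)
  | beta_lettens G D A B C (t : tm G None A) (s : tm G D (VComp B))
      (u : tm (A :: G) (Some B) (VComp C)) :
      eqt (tlettens (ttens t s) u) (sub u (scons t (@vid G)) (senv1 s))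
  | eta_lettens G D A B C (t : tm G D (VComp (CTens A B)))
      (u : tm G (Some (CTens A B)) (VComp C)) :
      eqt (tlettens t (fill (wk A u) (ttens (tvar (vz A G)) (tz _ B))))
          (fill u t)
  | eta_abort G D A (t : tm G D (VComp CZero))
      (u : tm G (Some CZero) (VComp A)) :
      eqt (tabort A t) (fill u t)
  | beta_inl G D A B C (t : tm G D (VComp A))
      (u : tm G (Some A) (VComp C)) (u' : tm G (Some B) (VComp C)) :
      eqt (tcase (tinl B t) u u') (fill u t)
  | beta_inr G D A B C (t : tm G D (VComp B))
      (u : tm G (Some A) (VComp C)) (u' : tm G (Some B) (VComp C)) :
      eqt (tcase (tinr A t) u u') (fill u' t)
  | eta_case G D A B C (t : tm G D (VComp (CSum A B)))
      (u : tm G (Some (CSum A B)) (VComp C)) :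
      eqt (tcase t (fill u (tinl B (tz G A))) (fill u (tinr A (tz G B))))
          (fill u t)
  | beta_lapp G D A B (t : tm G (Some A) (VComp B)) (u : tm G D (VComp A)) :
      eqt (tlapp (tllam t) u) (fill t u)
  | eta_llam G A B (t : tm G None (VLin A B)) :
      eqt (tllam (tlapp t (tz G A))) t.

(* The generic self-translation relative to R: [vbul] and [ccirc] on types,
   [vtr] and [ctr] on terms. *)
Section Translation.
Variable R : cty.

Fixpoint vbul (A : vty) : vty :=
  match A with
  | VConst a => VConst a
  | VUnit => VUnit
  | VProd A B => VProd (vbul A) (vbul B)
  | VArr A B => VArr (vbul A) (vbul B)
  | VComp A => VLin (ccirc A) R
  | VLin A B => VLin (ccirc B) (ccirc A)
  end
with ccirc (A : cty) : cty :=
  match A with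
  | CConst a =>
      match R with
      | CConst b => if b == a then CI else CConst a
      | _ => CConst a
      end
  | CUnit => CZero
  | CProd A B => CSum (ccirc A) (ccirc B)
  | CArr A B => CTens (vbul A) (ccirc B)
  | CI => R
  | CBang A => CArr (vbul A) R
  | CTens A B => CArr (vbul A) (ccirc B)
  | CZero => CUnit
  | CSum A B => CProd (ccirc A) (ccirc B)
  end.

Definition gbul (G : ctx) : ctx := map vbul G.

Fixpoint xbul G A (x : var G A) : var (gbul G) (vbul A) :=
  match x with
  | vz A G => vz (vbul A) (gbul G)
  | vs _ B _ x => vs (vbul B) (xbul x)
  end.

(* The translation of  G | - |- t : A  is a term of type A^bullet, the one of
   G | z : D |- t : B  is a term of type D^circ with stoup B^circ.  With a
   nonempty stoup the type is always a computation type, so the last case is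
   never reached. *)
Definition trT (G : ctx) (D : stoup) (A : vty) : Type :=
  match D with
  | None => tm (gbul G) None (vbul A)
  | Some D =>
      match A with
      | VComp B => tm (gbul G) (Some (ccirc B)) (VComp (ccirc D))
      | _ => unit
      end
  end.

(* As the stoup variable is nameless, renamings such as t^circ[k/k_z] are
   invisible; the other substitutions for k_z are instances of [fill]. *)
Fixpoint tr G D A (t : tm G D A) : trT G D A :=
  match t in tm G D A return trT G D A with
  | tvar _ _ x => tvar (xbul x)
  | tstar _ => tstar _
  | tpair _ _ _ t u => tpair (tr t) (tr u)
  | tfst _ _ _ t => tfst (tr t)
  | tsnd _ _ _ t => tsnd (tr t)
  | tlam _ _ _ t => tlam (tr t)
  | tapp _ _ _ t u => tapp (tr t) (tr u)
  | tz _ _ => tz _ _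
  | tcstar G D =>
      match D return trT G D (VComp CUnit) with
      | None => tllam (tabort R (tz _ _))
      | Some D => tabort (ccirc D) (tz _ _)
      end
  | tcpair G D A B t u =>
      match D return trT G D (VComp A) -> trT G D (VComp B) ->
                     trT G D (VComp (CProd A B)) with
      | None => fun t u =>
          tllam (tcase (tz _ _) (tlapp t (tz _ _)) (tlapp u (tz _ _)))
      | Some _ => fun t u => tcase (tz _ _) t u
      end (tr t) (tr u)
  | tcfst G D A B t =>
      match D return trT G D (VComp (CProd A B)) -> trT G D (VComp A) with
      | None => fun t => tllam (tlapp t (tinl _ (tz _ _)))
      | Some _ => fun t => fill t (tinl _ (tz _ _))
      end (tr t)
  | tcsnd G D A B t =>
      match D return trT G D (VComp (CProd A B)) -> trT G D (VComp B) with
      | None => fun t => tllam (tlapp t (tinr _ (tz _ _)))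
      | Some _ => fun t => fill t (tinr _ (tz _ _))
      end (tr t)
  | tclam G D A B t =>
      match D return trT (A :: G) D (VComp B) -> trT G D (VComp (CArr A B))
      with
      | None => fun t => tllam (tlettens (tz _ _) (tlapp t (tz _ _)))
      | Some _ => fun t => tlettens (tz _ _) t
      end (tr t)
  | tcapp G D A B s t =>
      match D return trT G D (VComp (CArr A B)) -> trT G None A ->
                     trT G D (VComp B) with
      | None => fun s t => tllam (tlapp s (ttens t (tz _ _)))
      | Some _ => fun s t => fill s (ttens t (tz _ _))
      end (tr s) (tr t)
  | ttop _ => tllam (tz _ R)
  | tlettop G D A t u =>
      match D return trT G D (VComp CI) -> trT G None (VComp A) ->
                     trT G D (VComp A) with
      | None => fun t u => tllam (tlapp t (tlapp u (tz _ _)))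
      | Some _ => fun t u => fill t (tlapp u (tz _ _))
      end (tr t) (tr u)
  | tbang _ _ t => tllam (tcapp (tz _ _) (tr t))
  | tletbang G D A B t u =>
      match D return trT G D (VComp (CBang A)) -> trT (A :: G) None (VComp B) ->
                     trT G D (VComp B) with
      | None => fun t u => tllam (tlapp t (tclam (tlapp u (tz _ _))))
      | Some _ => fun t u => fill t (tclam (tlapp u (tz _ _)))
      end (tr t) (tr u)
  | ttens G D A B t u =>
      match D return trT G None A -> trT G D (VComp B) ->
                     trT G D (VComp (CTens A B)) with
      | None => fun t u => tllam (tlapp u (tcapp (tz _ _) t))
      | Some _ => fun t u => fill u (tcapp (tz _ _) t)
      end (tr t) (tr u)
  | tlettens G D A B C s t =>
      match D return trT G D (VComp (CTens A B)) ->
                     trT (A :: G) (Some B) (VComp C) -> trT G D (VComp C) with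
      | None => fun s t => tllam (tlapp s (tclam t))
      | Some _ => fun s t => fill s (tclam t)
      end (tr s) (tr t)
  | tabort G D A t =>
      match D return trT G D (VComp CZero) -> trT G D (VComp A) with
      | None => fun t => tllam (tlapp t (tcstar _ _))
      | Some _ => fun t => fill t (tcstar _ _)
      end (tr t)
  | tinl G D A B t =>
      match D return trT G D (VComp A) -> trT G D (VComp (CSum A B)) with
      | None => fun t => tllam (tlapp t (tcfst (tz _ _)))
      | Some _ => fun t => fill t (tcfst (tz _ _))
      end (tr t)
  | tinr G D A B t =>
      match D return trT G D (VComp B) -> trT G D (VComp (CSum A B)) with
      | None => fun t => tllam (tlapp t (tcsnd (tz _ _)))
      | Some _ => fun t => fill t (tcsnd (tz _ _))
      end (tr t)
  | tcase G D A B C s t u =>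
      match D return trT G D (VComp (CSum A B)) ->
                     trT G (Some A) (VComp C) -> trT G (Some B) (VComp C) ->
                     trT G D (VComp C) with
      | None => fun s t u => tllam (tlapp s (tcpair t u))
      | Some _ => fun s t u => fill s (tcpair t u)
      end (tr s) (tr t) (tr u)
  | tllam _ _ _ t => tllam (tr t)
  | tlapp G D A B s t =>
      match D return trT G None (VLin A B) -> trT G D (VComp A) ->
                     trT G D (VComp B) with
      | None => fun s t => tllam (tlapp t (tlapp s (tz _ _)))
      | Some _ => fun s t => fill t (tlapp s (tz _ _))
      end (tr s) (tr t)
  end.

Definition vtr G A (t : tm G None A) : tm (gbul G) None (vbul A) := tr t.

Definition ctr G D B (t : tm G (Some D) (VComp B)) :
    tm (gbul G) (Some (ccirc B)) (VComp (ccirc D)) := tr t.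

Definition const_or_I : Prop := (exists a, R = CConst a) \/ R = CI.

Hypothesis HR : const_or_I.

Lemma ccirc_R : ccirc R = CI.
Proof. by case: HR => [[a E]|E]; rewrite E /= E ?eqxx. Qed.

Lemma ccirc_constK a : ccirc (ccirc (CConst a)) = CConst a.
Proof.
case: HR => [[b E]|E] /=; rewrite E /=; last by rewrite E.
by case: eqP => [<-//|ne]; rewrite /= E; case: eqP.
Qed.

(* transport along an equality of types; the identity on untyped terms *)
Definition ccast G D A B (E : A = B) (t : tm G D (VComp A)) :
    tm G D (VComp B) :=
  match E in _ = B return tm G D (VComp B) with erefl => t end.

Section Theta.
(* [vinv] and [cinv] are the chosen inverses: they are unique only up to
   provable equality, so the definition is parameterized by the choice, which
   [theta_inverses] constrains; [theta_inverses_exist] shows that a choice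
   exists. *)
Variable vinv : forall A, tm [::] None (VArr A (vbul (vbul A))).
Variable cinv : forall A, tm [::] None (VLin A (ccirc (ccirc A))).

Fixpoint theta (A : vty) : tm [::] None (VArr (vbul (vbul A)) A) :=
  match A with
  | VConst a => tlam (tvar (vz _ _))
  | VUnit => tlam (tstar _)
  | VProd A B =>
      tlam (tpair (tapp (wk0 _ (theta A)) (tfst (tvar (vz _ _))))
                  (tapp (wk0 _ (theta B)) (tsnd (tvar (vz _ _)))))
  | VArr A B =>
      tlam (tlam (tapp (wk0 _ (theta B))
        (tapp (tvar (vs _ (vz _ _)))
              (tapp (wk0 _ (vinv A)) (tvar (vz _ _))))))
  | VComp A =>
      (* h : R^circ -o A^circcirc, where R^circ is I *)
      tlam (tlapp (wk0 _ (ctheta A))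
        (tlapp (tvar (vz _ _)) (ccast (esym ccirc_R) (ttop _))))
  | VLin A B =>
      tlam (tllam (tlapp (wk0 _ (ctheta B))
        (tlapp (tvar (vz _ _)) (tlapp (wk0 _ (cinv A)) (tz _ _)))))
  end
with ctheta (A : cty) : tm [::] None (VLin (ccirc (ccirc A)) A) :=
  match A with
  | CConst a => tllam (ccast (ccirc_constK a) (tz _ _))
  | CUnit => tllam (tcstar _ _)
  | CProd A B =>
      tllam (tcpair (tlapp (ctheta A) (tcfst (tz _ _)))
                    (tlapp (ctheta B) (tcsnd (tz _ _))))
  | CArr A B =>
      tllam (tclam (tlapp (wk0 _ (ctheta B))
        (tcapp (tz _ _) (tapp (wk0 _ (vinv A)) (tvar (vz _ _))))))
  | CI => tllam (ccast ccirc_R (tz _ _))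
  | CBang A =>
      tllam (tlettens (tz _ _)
        (tlettop (ccast ccirc_R (tz _ _))
                 (tbang (tapp (wk0 _ (theta A)) (tvar (vz _ _))))))
  | CTens A B =>
      tllam (tlettens (tz _ _)
        (ttens (tapp (wk0 _ (theta A)) (tvar (vz _ _)))
               (tlapp (wk0 _ (ctheta B)) (tz _ _))))
  | CZero => tllam (tz _ _)
  | CSum A B =>
      tllam (tcase (tz _ _) (tinl _ (tlapp (ctheta A) (tz _ _)))
                            (tinr _ (tlapp (ctheta B) (tz _ _))))
  end.

Definition theta_inverses : Prop :=
  (forall A,
     eqt (tlam (tapp (wk0 _ (vinv A)) (tapp (wk0 _ (theta A))
            (tvar (vz _ [::])))))
         (tlam (tvar (vz _ [::]))) /\
     eqt (tlam (tapp (wk0 _ (theta A)) (tapp (wk0 _ (vinv A))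
            (tvar (vz _ [::])))))
         (tlam (tvar (vz _ [::])))) /\
  (forall A,
     eqt (tllam (tlapp (cinv A) (tlapp (ctheta A) (tz [::] _))))
         (tllam (tz [::] _)) /\
     eqt (tllam (tlapp (ctheta A) (tlapp (cinv A) (tz [::] _))))
         (tllam (tz [::] _))).

(* the simultaneous substitution [theta^-1(G)] *)
Fixpoint theta_env (G : ctx) : venv (gbul (gbul G)) G :=
  match G with
  | [::] => @vid [::]
  | C :: G =>
      scons (tapp (wk0 _ (vinv C)) (tvar (vz C G)))
            (fun B x => wk C (theta_env x))
  end.

End Theta.
End Translation.
End Syntax.

Arguments VUnit {VK CK}.
Arguments CUnit {VK CK}.
Arguments CI {VK CK}.
Arguments CZero {VK CK}.
Arguments theta_env [VK CK R] vinv G [A] x.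

(* Substitution lemmas, closure of provable equality under substitution, and
   from these the existence of the inverses ([theta_inverses_exist]). *)
Section Metatheory.
Variables (VK : Type) (CK : eqType).
Notation ctx := (ctx VK CK).
Notation vty := (vty VK CK).
Notation cty := (cty VK CK).

Lemma var_case (A : vty) (G : ctx) (P : forall B, var (A :: G) B -> Prop) :
  P A (vz A G) -> (forall B (y : var G B), P B (vs A y)) ->
  forall B x, P B x.
Proof.
move=> Hz Hs B x; move: P Hz Hs.
by refine (match x in var H B return
   match H return var H B -> Prop with
   | [::] => fun _ => True
   | A :: G => fun x => forall P : (forall B, var (A :: G) B -> Prop),
       P A (vz A G) -> (forall B y, P B (vs A y)) -> P B x
   end x with vz _ _ => fun P hz _ => hz | vs _ _ _ y => fun P _ hs => hs _ y end).
Qed.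

Lemma var_nil (B : vty) (x : var [::] B) (P : Prop) : P.
Proof.
by refine (match x in var H B return
   match H with [::] => P | _ => True end with vz _ _ => I | vs _ _ _ _ => I end).
Qed.

Lemma senv_case0 (G : ctx) (P : forall D, senv G None D -> Prop) :
  P None (senv0 G) -> forall D e, P D e.
Proof.
move=> H D e; move: P H.
by refine (match e in senv _ D0 D return
   match D0 return senv G D0 D -> Prop with
   | None => fun e => forall P : (forall D, senv G None D -> Prop),
       P None (senv0 G) -> P D e
   | Some _ => fun _ => True
   end e with senv0 => fun P h => h | senv1 _ _ _ => I end).
Qed.

Lemma senv_case1 (G : ctx) (B : cty) (P : forall D, senv G (Some B) D -> Prop) :
  (forall D u, P D (@senv1 _ _ G B D u)) -> forall D e, P D e.
Proof.
move=> H D e; move: P H.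
by refine (match e in senv _ D0 D return
   match D0 return senv G D0 D -> Prop with
   | Some B => fun e => forall P : (forall D, senv G (Some B) D -> Prop),
       (forall D u, P D (@senv1 _ _ G B D u)) -> P D e
   | None => fun _ => True
   end e with senv0 => I | senv1 _ _ _ => fun P h => h _ _ end).
Qed.

Lemma env_ext (G : ctx) (F : vty -> Type) (f g : forall A, var G A -> F A) :
  (forall A x, f A x = g A x) -> f = g.
Proof.
move=> H; apply: functional_extensionality_dep => A.
exact: functional_extensionality_dep.
Qed.

Definition rcomp (G G1 G2 : ctx) (r : renv G G1) (r' : renv G1 G2) : renv G G2 :=
  fun B x => r' B (r B x).
Definition rvcomp (G G1 G2 : ctx) (r : renv G G1) (s : venv G1 G2) : venv G G2 :=
  fun B x => s B (r B x).
Definition vrcomp (G G1 G2 : ctx) (s : venv G G1) (r : renv G1 G2) : venv G G2 :=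
  fun B x => ren (s B x) r.
Definition vcomp (G G1 G2 : ctx) (s : venv G G1) (s' : venv G1 G2) : venv G G2 :=
  fun B x => sub (s B x) s' (senv0 _).
Definition sren (G G' : ctx) D D' (e : senv G D D') (r : renv G G') : senv G' D D' :=
  match e with senv0 => senv0 _ | senv1 _ _ u => senv1 (ren u r) end.
Definition scomp (G G' : ctx) D D' D'' (e : senv G D D') (s : venv G G')
   (e' : senv G' D' D'') : senv G' D D'' :=
  match e in senv _ D D' return senv G' D' D'' -> senv G' D D'' with
   | senv0 => fun e' => e' | senv1 _ _ u => fun e' => senv1 (sub u s e') end e'.

Ltac ihs := repeat match goal with
  | H : forall _ : Defs.ctx _ _, _ |- _ => rewrite H; clear H end.

Lemma rlift_comp (G G1 G2 : ctx) A (r : renv G G1) (r' : renv G1 G2) :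
  rcomp (rlift (A:=A) r) (rlift r') = rlift (rcomp r r').
Proof. by apply: env_ext; apply: var_case. Qed.

Lemma ren_ren (G : ctx) D A (t : tm G D A) :
  forall G1 G2 (r : renv G G1) (r' : renv G1 G2), ren (ren t r) r' = ren t (rcomp r r').
Proof.
by elim: t => * //=; ihs; rewrite ?rlift_comp.
Qed.

Lemma rvlift (G G1 G2 : ctx) A (r : renv G G1) (s : venv G1 G2) :
  rvcomp (rlift (A:=A) r) (vlift s) = vlift (rvcomp r s).
Proof. by apply: env_ext; apply: var_case. Qed.

Lemma sub_ren (G : ctx) D A (t : tm G D A) :
  forall G1 G2 D' (r : renv G G1) (s : venv G1 G2) (e : senv G2 D D'),
  sub (ren t r) s e = sub t (rvcomp r s) e.
Proof.
by elim: t => * //=; ihs; rewrite ?rvlift.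
Qed.

Lemma vrlift (G G1 G2 : ctx) A (s : venv G G1) (r : renv G1 G2) :
  vrcomp (vlift (A:=A) s) (rlift r) = vlift (vrcomp s r).
Proof.
apply: env_ext; apply: var_case => // B y.
by rewrite /vrcomp /= /wk !ren_ren.
Qed.

Lemma sren_lift (G G1 : ctx) A D D' (e : senv G D D') (r : renv G G1) :
  sren (slift A e) (rlift r) = slift A (sren e r).
Proof. by case: e => //= B D0 u; rewrite /wk !ren_ren. Qed.

Lemma sren_id (G G1 : ctx) D (r : renv G G1) : sren (sid G D) r = sid G1 D.
Proof. by case: D. Qed.

Lemma ren_sempty (G G1 : ctx) A D (e : senv G None D) (t : tm G None A)
   (r : renv G G1) : ren (sempty e t) r = sempty (sren e r) (ren t r).
Proof. by move: D e; apply: senv_case0. Qed.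

Lemma ren_sub (G : ctx) D A (t : tm G D A) :
  forall G1 G2 D' (s : venv G G1) (e : senv G1 D D') (r : renv G1 G2),
  ren (sub t s e) r = sub t (vrcomp s r) (sren e r).
Proof.

elim: t => [*|*|*|*|*|*|*|G' B G1 G2 D' s e r|*|*|*|*|*|*|*|*|*|*|*|*|*|*|*|*|*|*].
8: by move: D' e; apply: senv_case1.
all: by rewrite /= ?ren_sempty /=; ihs; rewrite ?vrlift ?sren_lift ?sren_id.
Qed.

Lemma vlift_comp (G G1 G2 : ctx) A (s : venv G G1) (s' : venv G1 G2) :
  vcomp (vlift (A:=A) s) (vlift s') = vlift (vcomp s s').
Proof.
apply: env_ext; apply: var_case => // B y.
by rewrite /vcomp /= /wk sub_ren ren_sub.
Qed.

Lemma scomp_lift (G G1 : ctx) A D D' D'' (e : senv G D D') (s : venv G G1)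
    (e' : senv G1 D' D'') :
  scomp (slift A e) (vlift s) (slift A e') = slift A (scomp e s e').
Proof.
case: e e' => //= B D0 u e'; congr senv1.
rewrite /wk sub_ren ren_sub; congr (sub _ _ _); by case: e'.
Qed.

Lemma scomp_id (G G1 : ctx) D D' (s : venv G G1) (e : senv G1 D D') :
  scomp (sid G D) s e = e.
Proof. by case: e. Qed.

Lemma sub_sempty (G G1 : ctx) A D D' (e : senv G None D) (t : tm G None A)
    (s : venv G G1) (e' : senv G1 D D') :
  sub (sempty e t) s e' = sempty (scomp e s e') (sub t s (senv0 _)).
Proof. by move: D e e'; apply: senv_case0; move: D'; apply: senv_case0. Qed.

Lemma slift_id (G : ctx) A D : slift A (sid G D) = sid _ D.
Proof. by case: D. Qed.

Lemma sub_sub (G : ctx) D A (t : tm G D A) :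
  forall G1 G2 D' D'' (s : venv G G1) (e : senv G1 D D') (s' : venv G1 G2)
    (e' : senv G2 D' D''),
  sub (sub t s e) s' e' = sub t (vcomp s s') (scomp e s' e').
Proof.
elim: t => [*|*|*|*|*|*|*|G' B G1 G2 D' D'' s e s' e'|*|*|*|*|*|*|*|*|*|*|*|*|*|*|*|*|*|*].
8: by move: D' e e'; apply: senv_case1.
all: by rewrite /= ?sub_sempty /=; ihs; rewrite ?vlift_comp ?scomp_lift ?scomp_id.
Qed.

Lemma vlift_id (G : ctx) A : vlift (A:=A) (@vid _ _ G) = @vid _ _ _.
Proof. by apply: env_ext; apply: var_case. Qed.

Lemma sub_id (G : ctx) D A (t : tm G D A) : sub t (@vid _ _ G) (sid _ _) = t.
Proof. by elim: t => * //=; rewrite ?vlift_id ?slift_id /=; f_equal. Qed.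

Lemma ren_as_sub (G G1 : ctx) D A (t : tm G D A) (r : renv G G1) :
  ren t r = sub t (fun B x => tvar (r B x)) (sid _ _).
Proof. by rewrite -{1}(sub_id t) ren_sub sren_id. Qed.

Lemma sub_wk_cons (G G1 : ctx) D D' A B (t : tm G D A) (u : tm G1 None B)
    (s : venv G G1) (e : senv G1 D D') :
  sub (wk B t) (scons u s) e = sub t s e.
Proof. by rewrite /wk sub_ren. Qed.

Lemma sub_wk (G G1 : ctx) D D' A B (t : tm G D A) (s : venv G G1)
    (e : senv G1 D D') : sub (wk B t) (vlift s) (slift B e) = wk B (sub t s e).
Proof. by rewrite /wk sub_ren ren_sub; congr (sub _ _ _); case: e. Qed.

Lemma sub_wk_id (G G1 : ctx) D A B (t : tm G D A) (s : venv G G1) :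
  sub (wk B t) (vlift s) (sid _ _) = wk B (sub t s (sid _ _)).
Proof. by rewrite -sub_wk slift_id. Qed.

Lemma sub_wk_none (G G1 : ctx) A B (t : tm G None A) (s : venv G G1) :
  sub (wk B t) (vlift s) (senv0 _) = wk B (sub t s (senv0 _)).
Proof. exact: sub_wk_id. Qed.

Lemma vcomp_idr (G G1 : ctx) (s : venv G G1) : vcomp s (@vid _ _ _) = s.
Proof. by apply: env_ext => A x; apply: (sub_id (s A x)). Qed.

Lemma vcomp_cons (G G1 G2 : ctx) A (u : tm G1 None A) (s : venv G G1)
    (s' : venv G1 G2) :
  vcomp (scons u s) s' = scons (sub u s' (senv0 _)) (vcomp s s').
Proof. by apply: env_ext; apply: var_case. Qed.

Lemma vlift_cons (G G1 G2 : ctx) A (s : venv G G1) (u : tm G2 None A)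
    (s' : venv G1 G2) :
  vcomp (vlift s) (scons u s') = scons u (vcomp s s').
Proof.
apply: env_ext; apply: var_case => //= B y.
by rewrite /vcomp /= sub_wk_cons.
Qed.

Lemma scomp_lift_cons (G G1 : ctx) A D D' D'' (e : senv G D D') (u : tm G1 None A)
  (s : venv G G1) (e' : senv G1 D' D'') :
  scomp (slift A e) (scons u s) e' = scomp e s e'.
Proof. by case: e e' => //= B D0 v e'; rewrite sub_wk_cons. Qed.

Lemma scomp_idr (G : ctx) D D' (e : senv G D D') :
  scomp e (@vid _ _ G) (sid G D') = e.
Proof. by case: e => //= B D0 u; rewrite sub_id. Qed.

Lemma sub_inst (G G1 : ctx) D D' A B (t : tm (A :: G) D B) (u : tm G None A)
    (s : venv G G1) (e : senv G1 D D') :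
  sub (inst t u) s e = inst (sub t (vlift s) (slift A e)) (sub u s (senv0 _)).
Proof.
rewrite /inst /vsub !sub_sub scomp_id vcomp_cons vlift_cons vcomp_idr.
by rewrite scomp_lift_cons scomp_idr.
Qed.

Lemma sub_fill (G G1 : ctx) D D' A B (t : tm G (Some B) A) (u : tm G D (VComp B))
    (s : venv G G1) (e : senv G1 D D') :
  sub (fill t u) s e = fill (sub t s (sid _ _)) (sub u s e).
Proof. by rewrite /fill !sub_sub scomp_id vcomp_idr. Qed.

Lemma eqt_sub (G : ctx) D A (t u : tm G D A) : eqt t u ->
  forall G1 D' (s : venv G G1) (e : senv G1 D D'), eqt (sub t s e) (sub u s e).
Proof.
elim=> {G D A t u}.
- by move=> *; apply: eqt_refl.
- by move=> *; apply: eqt_sym; auto.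
- by move=> G D A t u v _ IH _ IH' *; apply: eqt_trans (IH _ _ _ _) (IH' _ _ _ _).
all: move=> *.
all: match goal with
  | e : senv _ None ?D' |- _ => move: D' e; apply: senv_case0
  | _ => idtac end.
all: rewrite /= ?sub_inst ?sub_fill ?sub_wk_none ?sub_wk_id ?sub_wk /=.
all: try by constructor; auto.
all: try by apply: eta_abort.
1: { set u' := (X in eqt _ X).
     match goal with t : tm _ None ?A, x : tm _ ?D _, u : tm _ (Some _) _, s : venv _ _, e : senv _ ?D _ |- _ =>
       have E : u' = sub (sub u (vlift s) (sid _ _)) (scons (sub t s (senv0 _)) (@vid _ _ _)) (senv1 (sub x s e)) end.
     by rewrite /u' !sub_sub /= vcomp_cons vlift_cons vcomp_idr.
     rewrite E; apply: beta_lettens. }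
Qed.

#[local] Instance eqt_equiv (G : ctx) D A : Equivalence (@eqt VK CK G D A).
Proof.
by split; [exact: eqt_refl | exact: eqt_sym | exact: eqt_trans].
Qed.

#[local] Hint Resolve eqt_refl : core.
Local Notation Eq := (@eqt VK CK _ _ _).
#[local] Instance p_pair G A B :
  Proper (Eq ==> Eq ==> Eq) (@tpair VK CK G A B).
Proof. by repeat intro; constructor. Qed.
#[local] Instance p_fst G A B :
  Proper (Eq ==> Eq) (@tfst VK CK G A B).
Proof. by repeat intro; constructor. Qed.
#[local] Instance p_snd G A B :
  Proper (Eq ==> Eq) (@tsnd VK CK G A B).
Proof. by repeat intro; constructor. Qed.
#[local] Instance p_lam G A B :
  Proper (Eq ==> Eq) (@tlam VK CK G A B).
Proof. by repeat intro; constructor. Qed.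
#[local] Instance p_app G A B :
  Proper (Eq ==> Eq ==> Eq) (@tapp VK CK G A B).
Proof. by repeat intro; constructor. Qed.
#[local] Instance p_cpair G D A B :
  Proper (Eq ==> Eq ==> Eq) (@tcpair VK CK G D A B).
Proof. by repeat intro; constructor. Qed.
#[local] Instance p_cfst G D A B :
  Proper (Eq ==> Eq) (@tcfst VK CK G D A B).
Proof. by repeat intro; constructor. Qed.
#[local] Instance p_csnd G D A B :
  Proper (Eq ==> Eq) (@tcsnd VK CK G D A B).
Proof. by repeat intro; constructor. Qed.
#[local] Instance p_clam G D A B :
  Proper (Eq ==> Eq) (@tclam VK CK G D A B).
Proof. by repeat intro; constructor. Qed.
#[local] Instance p_capp G D A B :
  Proper (Eq ==> Eq ==> Eq) (@tcapp VK CK G D A B).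
Proof. by repeat intro; constructor. Qed.
#[local] Instance p_lettop G D A :
  Proper (Eq ==> Eq ==> Eq) (@tlettop VK CK G D A).
Proof. by repeat intro; constructor. Qed.
#[local] Instance p_bang G A :
  Proper (Eq ==> Eq) (@tbang VK CK G A).
Proof. by repeat intro; constructor. Qed.
#[local] Instance p_letbang G D A B :
  Proper (Eq ==> Eq ==> Eq) (@tletbang VK CK G D A B).
Proof. by repeat intro; constructor. Qed.
#[local] Instance p_tens G D A B :
  Proper (Eq ==> Eq ==> Eq) (@ttens VK CK G D A B).
Proof. by repeat intro; constructor. Qed.
#[local] Instance p_lettens G D A B C :
  Proper (Eq ==> Eq ==> Eq) (@tlettens VK CK G D A B C).
Proof. by repeat intro; constructor. Qed.
#[local] Instance p_inl G D A B :
  Proper (Eq ==> Eq) (@tinl VK CK G D A B).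
Proof. by repeat intro; constructor. Qed.
#[local] Instance p_inr G D A B :
  Proper (Eq ==> Eq) (@tinr VK CK G D A B).
Proof. by repeat intro; constructor. Qed.
#[local] Instance p_case G D A B C :
  Proper (Eq ==> Eq ==> Eq ==> Eq) (@tcase VK CK G D A B C).
Proof. by repeat intro; constructor. Qed.
#[local] Instance p_llam G A B :
  Proper (Eq ==> Eq) (@tllam VK CK G A B).
Proof. by repeat intro; constructor. Qed.
#[local] Instance p_lapp G D A B :
  Proper (Eq ==> Eq ==> Eq) (@tlapp VK CK G D A B).
Proof. by repeat intro; constructor. Qed.
#[local] Instance p_cast G D A B e : Proper (Eq ==> Eq) (@ccast VK CK G D A B e).
Proof. by case: _ / e. Qed.

Lemma env_nil (G : ctx) (s s' : venv [::] G) : s = s'.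
Proof. by apply: env_ext => A x; apply: (var_nil x). Qed.

Lemma sub_wk0 (G G1 : ctx) A (t : tm [::] None A) (s : venv G G1) :
  sub (wk0 G t) s (senv0 _) = wk0 G1 t.
Proof. rewrite /wk0 sub_ren ren_as_sub; congr (sub _ _ _); exact: env_nil. Qed.

Lemma ren_wk0 (G G1 : ctx) A (t : tm [::] None A) (r : renv G G1) :
  ren (wk0 G t) r = wk0 G1 t.
Proof. by rewrite ren_as_sub sub_wk0. Qed.

Lemma wk0_id A (t : @tm VK CK [::] None A) : wk0 [::] t = t.
Proof. rewrite /wk0 ren_as_sub -[RHS]sub_id; congr (sub _ _ _); exact: env_nil. Qed.

Definition vnil G : @venv VK CK [::] G := fun A x =>
  match x in var H A return match H with [::] => tm G None A | _ => unit end with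
  vz _ _ => tt | vs _ _ _ _ => tt end.

Lemma sub_closed (G1 : ctx) A (t : tm [::] None A) (s : venv [::] G1) :
  sub t s (senv0 _) = wk0 G1 t.
Proof. by rewrite -(sub_wk0 t s) wk0_id. Qed.

Lemma beta0 (G : ctx) A B (b : tm [:: A] None B) (a : tm G None A) :
  eqt (tapp (wk0 G (tlam b)) a) (sub b (scons a (@vnil G)) (senv0 _)).
Proof.
rewrite /wk0 /= beta_app /inst /vsub sub_ren.
match goal with |- eqt (sub _ ?s _) (sub _ ?s' _) => have -> : s = s' end; last by [].
by apply: env_ext; apply: var_case => // C y; apply: (var_nil y).
Qed.

Lemma lbeta0 (G : ctx) D A B (b : tm [::] (Some A) (VComp B)) (a : tm G D (VComp A)) :
  eqt (tlapp (wk0 G (tllam b)) a) (sub b (@vnil G) (senv1 a)).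
Proof.
rewrite /wk0 /= beta_lapp /fill sub_ren.
match goal with |- eqt (sub _ ?s _) (sub _ ?s' _) => have -> : s = s' by apply: env_nil end.
by [].
Qed.

Lemma sub_cast (G G1 : ctx) D D' A B (E : A = B) (t : tm G D (VComp A)) (s : venv G G1)
  (e : senv G1 D D') : sub (ccast E t) s e = ccast E (sub t s e).
Proof. by case: _ / E. Qed.

Lemma castK (G : ctx) D A B (E : A = B) (t : tm G D (VComp A)) (E' : B = A) :
   E' = esym E -> ccast E' (ccast E t) = t.
Proof. by move=> ->; case: _ / E. Qed.

Lemma castKV (G : ctx) D A B (E : A = B) (t : tm G D (VComp B)) :
   ccast E (ccast (esym E) t) = t.
Proof. by case: _ / E t. Qed.

Lemma ext_bang (G : ctx) D A B (u v : tm G (Some (CBang A)) (VComp B)) (t : tm G D _) :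
  eqt (fill (wk A u) (tbang (tvar (vz A G)))) (fill (wk A v) (tbang (tvar (vz A G)))) ->
  eqt (fill u t) (fill v t).
Proof. by move=> H; rewrite -(eta_letbang t u) -(eta_letbang t v) H. Qed.

Lemma ext_tens (G : ctx) D A B C (u v : tm G (Some (CTens A B)) (VComp C)) (t : tm G D _) :
  eqt (fill (wk A u) (ttens (tvar (vz A G)) (tz _ _))) (fill (wk A v) (ttens (tvar (vz A G)) (tz _ _))) ->
  eqt (fill u t) (fill v t).
Proof. by move=> H; rewrite -(eta_lettens t u) -(eta_lettens t v) H. Qed.

Lemma ext_sum (G : ctx) D A B C (u v : tm G (Some (CSum A B)) (VComp C)) (t : tm G D _) :
  eqt (fill u (tinl _ (tz _ _))) (fill v (tinl _ (tz _ _))) ->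
  eqt (fill u (tinr _ (tz _ _))) (fill v (tinr _ (tz _ _))) ->
  eqt (fill u t) (fill v t).
Proof. by move=> H H'; rewrite -(eta_case t u) -(eta_case t v) H H'. Qed.

Lemma ext_I (G : ctx) D C (u v : tm G (Some CI) (VComp C)) (t : tm G D _) :
  eqt (fill u (ttop _)) (fill v (ttop _)) ->
  eqt (fill u t) (fill v t).
Proof. by move=> H; rewrite -(eta_lettop t u) -(eta_lettop t v) H. Qed.

Section Inv.
Variables (R : cty) (HR : const_or_I R).
Notation bb A := (vbul R (vbul R A)).
Notation cc A := (ccirc R (ccirc R A)).

Fixpoint viso (A : vty) : tm [::] None (VArr (bb A) A) * tm [::] None (VArr A (bb A)) :=
  match A with
  | VConst a => (tlam (tvar (vz _ _)), tlam (tvar (vz _ _)))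
  | VUnit => (tlam (tstar _), tlam (tstar _))
  | VProd A B =>
     (tlam (tpair (tapp (wk0 _ (viso A).1) (tfst (tvar (vz _ _))))
                  (tapp (wk0 _ (viso B).1) (tsnd (tvar (vz _ _))))),
      tlam (tpair (tapp (wk0 _ (viso A).2) (tfst (tvar (vz _ _))))
                  (tapp (wk0 _ (viso B).2) (tsnd (tvar (vz _ _))))))
  | VArr A B =>
     (tlam (tlam (tapp (wk0 _ (viso B).1)
        (tapp (tvar (vs _ (vz _ _)))
              (tapp (wk0 _ (viso A).2) (tvar (vz _ _)))))),
      tlam (tlam (tapp (wk0 _ (viso B).2)
        (tapp (tvar (vs _ (vz _ _)))
              (tapp (wk0 _ (viso A).1) (tvar (vz _ _)))))))
  | VComp A =>
     (tlam (tlapp (wk0 _ (ciso A).1)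
        (tlapp (tvar (vz _ _)) (ccast (esym (ccirc_R HR)) (ttop _)))),
      tlam (tllam (tlettop (ccast (ccirc_R HR) (tz _ _))
        (tlapp (wk0 _ (ciso A).2) (tvar (vz _ _))))))
  | VLin A B =>
     (tlam (tllam (tlapp (wk0 _ (ciso B).1)
        (tlapp (tvar (vz _ _)) (tlapp (wk0 _ (ciso A).2) (tz _ _))))),
      tlam (tllam (tlapp (wk0 _ (ciso B).2)
        (tlapp (tvar (vz _ _)) (tlapp (wk0 _ (ciso A).1) (tz _ _))))))
  end
with ciso (A : cty) : tm [::] None (VLin (cc A) A) * tm [::] None (VLin A (cc A)) :=
  match A with
  | CConst a => (tllam (ccast (ccirc_constK HR a) (tz _ _)),
                 tllam (ccast (esym (ccirc_constK HR a)) (tz _ _)))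
  | CUnit => (tllam (tcstar _ _), tllam (tcstar _ _))
  | CProd A B =>
     (tllam (tcpair (tlapp (ciso A).1 (tcfst (tz _ _)))
                    (tlapp (ciso B).1 (tcsnd (tz _ _)))),
      tllam (tcpair (tlapp (ciso A).2 (tcfst (tz _ _)))
                    (tlapp (ciso B).2 (tcsnd (tz _ _)))))
  | CArr A B =>
     (tllam (tclam (tlapp (wk0 _ (ciso B).1)
        (tcapp (tz _ _) (tapp (wk0 _ (viso A).2) (tvar (vz _ _)))))),
      tllam (tclam (tlapp (wk0 _ (ciso B).2)
        (tcapp (tz _ _) (tapp (wk0 _ (viso A).1) (tvar (vz _ _)))))))
  | CI => (tllam (ccast (ccirc_R HR) (tz _ _)), tllam (ccast (esym (ccirc_R HR)) (tz _ _)))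
  | CBang A =>
     (tllam (tlettens (tz _ _)
        (tlettop (ccast (ccirc_R HR) (tz _ _))
                 (tbang (tapp (wk0 _ (viso A).1) (tvar (vz _ _)))))),
      tllam (tletbang (tz _ _)
        (ttens (tapp (wk0 _ (viso A).2) (tvar (vz _ _)))
               (ccast (esym (ccirc_R HR)) (ttop _)))))
  | CTens A B =>
     (tllam (tlettens (tz _ _)
        (ttens (tapp (wk0 _ (viso A).1) (tvar (vz _ _)))
               (tlapp (wk0 _ (ciso B).1) (tz _ _)))),
      tllam (tlettens (tz _ _)
        (ttens (tapp (wk0 _ (viso A).2) (tvar (vz _ _)))
               (tlapp (wk0 _ (ciso B).2) (tz _ _)))))
  | CZero => (tllam (tz _ _), tllam (tz _ _))
  | CSum A B =>
     (tllam (tcase (tz _ _) (tinl _ (tlapp (ciso A).1 (tz _ _)))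
                            (tinr _ (tlapp (ciso B).1 (tz _ _)))),
      tllam (tcase (tz _ _) (tinl _ (tlapp (ciso A).2 (tz _ _)))
                            (tinr _ (tlapp (ciso B).2 (tz _ _)))))
  end.

Scheme vty_mind := Induction for Defs.vty Sort Prop
with cty_mind := Induction for Defs.cty Sort Prop.
Combined Scheme ty_mind from vty_mind, cty_mind.

Let vi A := (viso A).2.
Let ci A := (ciso A).2.

Lemma theta_iso : (forall A, theta HR vi ci A = (viso A).1) /\ (forall A, ctheta HR vi ci A = (ciso A).1).
Proof.
apply: ty_mind => //=; intros; repeat match goal with H : _ = _ |- _ => rewrite H; clear H end; done.
Qed.

Definition vprop A :=
  (forall G (a : tm G None (bb A)), eqt (tapp (wk0 G (viso A).2) (tapp (wk0 G (viso A).1) a)) a) /\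
  (forall G (a : tm G None A), eqt (tapp (wk0 G (viso A).1) (tapp (wk0 G (viso A).2) a)) a).
Definition cprop A :=
  (forall G D (a : tm G D (VComp (cc A))), eqt (tlapp (wk0 G (ciso A).2) (tlapp (wk0 G (ciso A).1) a)) a) /\
  (forall G D (a : tm G D (VComp A)), eqt (tlapp (wk0 G (ciso A).1) (tlapp (wk0 G (ciso A).2) a)) a).

Lemma wk_wk0 (G : ctx) A B (t : tm [::] None A) : wk B (wk0 G t) = wk0 (B :: G) t.
Proof. exact: ren_wk0. Qed.
Lemma wk_app (G : ctx) A B C (t : tm G None (VArr A B)) u :
  wk C (tapp t u) = tapp (wk C t) (wk C u).
Proof. by []. Qed.
Lemma wk_lapp (G : ctx) D A B C (t : tm G None (VLin A B)) (u : tm G D _) :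
  wk C (tlapp t u) = tlapp (wk C t) (wk C u).
Proof. by []. Qed.

Lemma sub_id0 (G : ctx) A (t : tm G None A) : sub t (@vid _ _ G) (senv0 _) = t.
Proof. exact: sub_id. Qed.
Ltac sm := rewrite /fill /= -/(@sub VK CK) ?sub_wk0 ?sub_closed ?sub_cast ?sub_id0 /=
   ?wk_app ?wk_lapp ?wk_wk0 ?ren_wk0 /=.

Section Cext.
Variables (G : ctx) (D : stoup VK CK).
Lemma cext_bang A B (f : tm [::] None (VLin B (CBang A))) (g : tm [::] None (VLin (CBang A) B))
  (x : tm G D _) :
  eqt (tlapp (wk0 _ f) (tlapp (wk0 _ g) (tbang (tvar (vz A G))))) (tbang (tvar (vz A G))) ->
  eqt (tlapp (wk0 _ f) (tlapp (wk0 _ g) x)) x.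
Proof.
move=> H.
have := @ext_bang G D _ _ (tlapp (wk0 _ f) (tlapp (wk0 _ g) (tz _ _))) (tz _ _) x.
by sm; apply.
Qed.
Lemma cext_tens A C B (f : tm [::] None (VLin B (CTens A C))) (g : tm [::] None (VLin (CTens A C) B))
  (x : tm G D _) :
  eqt (tlapp (wk0 _ f) (tlapp (wk0 _ g) (ttens (tvar (vz A G)) (tz _ _)))) (ttens (tvar (vz A G)) (tz _ _)) ->
  eqt (tlapp (wk0 _ f) (tlapp (wk0 _ g) x)) x.
Proof.
move=> H.
have := @ext_tens G D _ _ _ (tlapp (wk0 _ f) (tlapp (wk0 _ g) (tz _ _))) (tz _ _) x.
by sm; apply.
Qed.
Lemma cext_sum A C B (f : tm [::] None (VLin B (CSum A C))) (g : tm [::] None (VLin (CSum A C) B))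
  (x : tm G D _) :
  eqt (tlapp (wk0 _ f) (tlapp (wk0 _ g) (tinl _ (tz _ _)))) (tinl _ (tz G _)) ->
  eqt (tlapp (wk0 _ f) (tlapp (wk0 _ g) (tinr _ (tz _ _)))) (tinr _ (tz G _)) ->
  eqt (tlapp (wk0 _ f) (tlapp (wk0 _ g) x)) x.
Proof.
move=> H.
have := @ext_sum G D _ _ _ (tlapp (wk0 _ f) (tlapp (wk0 _ g) (tz _ _))) (tz _ _) x.
by sm; apply.
Qed.
End Cext.

Ltac ev := rewrite /=; repeat ((rewrite beta0 || rewrite lbeta0);
   rewrite /= ?sub_wk0 ?sub_closed ?sub_cast /= ?wk_app ?wk_lapp ?wk_wk0 /=).

Lemma viso_inverses : theta_inverses HR vi ci.
Proof.
have [Ev Ec] := theta_iso.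
suff [Hv Hc] : (forall A, vprop A) /\ (forall A, cprop A).
  split=> A; rewrite ?Ev ?Ec.
    by split; apply: cong_lam; [apply: (Hv A).1 | apply: (Hv A).2].
  by rewrite -(wk0_id (ciso A).1) -(wk0_id (ci A)); split; apply: cong_llam;
    [apply: (Hc A).1 | apply: (Hc A).2].
apply: ty_mind.
- by move=> a; split => G x; ev.
- by split => G x; apply: eqt_trans (eta_star _) (eqt_sym (eta_star _)).
- by move=> A [HA HA'] B [HB HB']; split => G x; ev;
    rewrite beta_fst beta_snd ?HA ?HB ?HA' ?HB' eta_pair.
- by move=> A [HA HA'] B [HB HB']; split => G x; ev;
    rewrite beta_app /inst /vsub /= !sub_wk0 sub_wk_cons sub_id 
     ?HA ?HB ?HA' ?HB' eta_lam.
- move=> A [HA HA']; split => G x; ev.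
    rewrite HA.
    have := eta_lettop (ccast (ccirc_R HR) (tz G (ccirc R R)))
              (tlapp x (ccast (esym (ccirc_R HR)) (tz G CI))).
    by sm => ->; rewrite castK // eta_llam.
  by rewrite beta_lapp; sm; rewrite castKV beta_lettop HA'.
- by move=> A [HA HA'] B [HB HB']; split => G x; ev;
    rewrite beta_lapp; sm; rewrite ?HA ?HB ?HA' ?HB' eta_llam.
- by move=> a; split => G D x; ev; rewrite ?castKV ?castK.
- by split => G D x; apply: eqt_trans (eta_cstar _) (eqt_sym (eta_cstar _)).
- by move=> A [HA HA'] B [HB HB']; split => G D x; ev;
    rewrite beta_cfst beta_csnd ?HA ?HB ?HA' ?HB' eta_cpair.
- by move=> A [HA HA'] B [HB HB']; split => G D x; ev;
    rewrite beta_capp /inst /vsub /= !sub_wk0 sub_wk_cons sub_id 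
     ?HA ?HB ?HA' ?HB' eta_clam.
- by split => G D x; ev; rewrite ?castKV ?castK.
- move=> A [HA HA']; split => G D x.
    apply: cext_tens; ev; rewrite beta_lettens; sm.
    pose E := ccirc_R HR.
    have := @ext_I (bb A :: G) (Some (ccirc R R)) _
       (tletbang (tlettop (tz _ _) (tbang (tapp (wk0 _ (viso A).1)
                     (tvar (vz (bb A) G)))))
           (ttens (tapp (wk0 _ (viso A).2) (tvar (vz _ _))) (ccast (esym E) (ttop _))))
         (ttens (tvar (vz _ _)) (ccast (esym E) (tz _ _)))
       (ccast E (tz _ _)).
    sm; rewrite (castK (E := E)) //; apply.
    by rewrite beta_lettop beta_letbang /inst /vsub; sm; rewrite HA.
  apply: cext_bang; ev; rewrite beta_letbang /inst /vsub; sm.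
  by rewrite beta_lettens; sm; rewrite castKV beta_lettop HA'.
- by move=> A [HA HA'] B [HB HB']; split => G D x; apply: cext_tens; ev;
    rewrite beta_lettens; sm; rewrite beta_lettens; sm; rewrite ?HA ?HB ?HA' ?HB'.
- by split => G D x; ev.
- by move=> A [HA HA'] B [HB HB']; split => G D x; apply: cext_sum; ev;
    rewrite ?beta_inl ?beta_inr; sm; rewrite ?beta_inl ?beta_inr; sm;
    rewrite ?HA ?HB ?HA' ?HB'.
Qed.

Lemma theta_inverses_exist :
  exists vinv cinv, theta_inverses HR vinv cinv.
Proof. by exists vi, ci; apply: viso_inverses. Qed.
End Inv.
End Metatheory.

(* Main.v *)
(** Double translation is covariant, so it should commute with every term former.
    For a term with a stoup this is a matter of unwinding, once one knows that
    [ctr] turns substitution for the stoup variable into substitution in the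
    opposite order ([ctr_fill]), which only holds up to the commuting conversions.
    A computation term without stoup has a translation of type
    [VLin (ccirc R B) R]; applying it to the stoup variable makes it look like the
    translation of a term whose stoup has dual [R], so that both kinds of
    computation terms are handled alike ([cps], [cps2]).  The theorem follows by
    induction on the term: each [theta] commutes with the same term former, and
    the inverses placed in the context cancel against the [theta]s produced by the
    binders.  Soundness of the translation for provable equality is not needed. *)

From Stdlib Require Import Setoid Morphisms.
Require Import Defs.
From mathcomp Require Import ssreflect ssrfun ssrbool eqtype seq.

Set Implicit Arguments.
Unset Strict Implicit.
Unset Printing Implicit Defensive.

Section SelfTranslation.
Variables (VK : Type) (CK : eqType).
Notation ctx := (ctx VK CK).
Notation vty := (vty VK CK).
Notation cty := (cty VK CK).
Notation stoup := (stoup VK CK).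
Local Notation Eq := (@eqt VK CK _ _ _).

(** * Provable equality as a congruence for rewriting *)

#[local] Instance eqt_equivalence (G : ctx) D A : Equivalence (@eqt VK CK G D A).
Proof. by split; [exact: eqt_refl | exact: eqt_sym | exact: eqt_trans]. Qed.

#[local] Hint Resolve eqt_refl : core.

Ltac congruence_rule := by repeat intro; constructor.
#[local] Instance pair_proper G A B : Proper (Eq ==> Eq ==> Eq) (@tpair VK CK G A B).
Proof. congruence_rule. Qed.
#[local] Instance fst_proper G A B : Proper (Eq ==> Eq) (@tfst VK CK G A B).
Proof. congruence_rule. Qed.
#[local] Instance snd_proper G A B : Proper (Eq ==> Eq) (@tsnd VK CK G A B).
Proof. congruence_rule. Qed.
#[local] Instance app_proper G A B : Proper (Eq ==> Eq ==> Eq) (@tapp VK CK G A B).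
Proof. congruence_rule. Qed.
#[local] Instance cpair_proper G D A B :
  Proper (Eq ==> Eq ==> Eq) (@tcpair VK CK G D A B).
Proof. congruence_rule. Qed.
#[local] Instance cfst_proper G D A B : Proper (Eq ==> Eq) (@tcfst VK CK G D A B).
Proof. congruence_rule. Qed.
#[local] Instance csnd_proper G D A B : Proper (Eq ==> Eq) (@tcsnd VK CK G D A B).
Proof. congruence_rule. Qed.
#[local] Instance capp_proper G D A B : Proper (Eq ==> Eq ==> Eq) (@tcapp VK CK G D A B).
Proof. congruence_rule. Qed.
#[local] Instance lettop_proper G D A : Proper (Eq ==> Eq ==> Eq) (@tlettop VK CK G D A).
Proof. congruence_rule. Qed.
#[local] Instance letbang_proper G D A B :
  Proper (Eq ==> Eq ==> Eq) (@tletbang VK CK G D A B).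
Proof. congruence_rule. Qed.
#[local] Instance tens_proper G D A B : Proper (Eq ==> Eq ==> Eq) (@ttens VK CK G D A B).
Proof. congruence_rule. Qed.
#[local] Instance lettens_proper G D A B C :
  Proper (Eq ==> Eq ==> Eq) (@tlettens VK CK G D A B C).
Proof. congruence_rule. Qed.
#[local] Instance abort_proper G D A : Proper (Eq ==> Eq) (@tabort VK CK G D A).
Proof. congruence_rule. Qed.
#[local] Instance inl_proper G D A B : Proper (Eq ==> Eq) (@tinl VK CK G D A B).
Proof. congruence_rule. Qed.
#[local] Instance inr_proper G D A B : Proper (Eq ==> Eq) (@tinr VK CK G D A B).
Proof. congruence_rule. Qed.
#[local] Instance case_proper G D A B C :
  Proper (Eq ==> Eq ==> Eq ==> Eq) (@tcase VK CK G D A B C).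
Proof. congruence_rule. Qed.
#[local] Instance llam_proper G A B : Proper (Eq ==> Eq) (@tllam VK CK G A B).
Proof. congruence_rule. Qed.
#[local] Instance lapp_proper G D A B : Proper (Eq ==> Eq ==> Eq) (@tlapp VK CK G D A B).
Proof. congruence_rule. Qed.

(** By [beta_lapp], a filling is provably a linear application of an abstraction, so the congruence
    rules suffice and no induction on terms is made. *)
#[local] Instance fill_proper G D A B :
  Proper (Eq ==> Eq ==> Eq) (@fill VK CK G D (VComp A) B).
Proof.
by move=> t t' tt' u u' uu'; rewrite -(beta_lapp t u) -(beta_lapp t' u') tt' uu'.
Qed.

(** * Algebra of stoup substitution *)

Lemma fill_tz (G : ctx) A B (t : tm G (Some B) A) : fill t (tz _ _) = t.
Proof. exact: (sub_id t). Qed.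

Lemma fill_fill (G : ctx) D A B C (t : tm G (Some B) A) (u : tm G (Some C) (VComp B))
    (v : tm G D (VComp C)) : fill (fill t u) v = fill t (fill u v).
Proof. by rewrite /fill sub_sub /= vcomp_idr. Qed.

Lemma ren_fill (G G' : ctx) D A B (t : tm G (Some B) A) (u : tm G D (VComp B))
    (r : renv G G') : ren (fill t u) r = fill (ren t r) (ren u r).
Proof. by rewrite !ren_as_sub sub_fill. Qed.

Lemma fill_clam (G : ctx) D A B C (t : tm (A :: G) (Some B) (VComp C))
    (u : tm G D (VComp B)) : fill (tclam t) u = tclam (fill t (wk A u)).
Proof. by rewrite /fill /= vlift_id. Qed.

Lemma sub_id_none (G : ctx) A (t : tm G None A) : sub t (@vid _ _ G) (senv0 _) = t.
Proof. exact: sub_id. Qed.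

Lemma sub_id_some (G : ctx) A B (t : tm G (Some A) B) :
  sub t (@vid _ _ G) (senv1 (tz _ _)) = t.
Proof. exact: sub_id. Qed.

Lemma sub_ren_lift_cons (G : ctx) D D' A B (t : tm (A :: G) D B)
    (e : senv (A :: G) D D') :
  sub (ren t (rlift (fun C x => vs A x))) (scons (tvar (vz A G)) (@vid _ _ _)) e
    = sub t (@vid _ _ _) e.
Proof. by rewrite sub_ren; congr (sub _ _ _); apply: env_ext; apply: var_case. Qed.

(** * Commuting conversions *)

(** Commuting conversions are hidden in the eta rules: apply eta to [k] filled with the eliminator
    of the stoup variable, and let the branches compute by beta. The next two lemmas follow the same
    pattern. *)
Lemma fill_case (G : ctx) D A B C E (s : tm G D (VComp (CSum A B)))
    (t : tm G (Some A) (VComp C)) (u : tm G (Some B) (VComp C))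
    (k : tm G (Some C) (VComp E)) :
  eqt (fill k (tcase s t u)) (tcase s (fill k t) (fill k u)).
Proof.
have := eta_case s (fill k (tcase (tz _ _) t u)).
rewrite !fill_fill {2 4 6}/fill /= !sub_id_some => <-.
by rewrite beta_inl beta_inr !fill_tz.
Qed.

Lemma fill_lettens (G : ctx) D A B C E (s : tm G D (VComp (CTens A B)))
    (t : tm (A :: G) (Some B) (VComp C)) (k : tm G (Some C) (VComp E)) :
  eqt (fill k (tlettens s t)) (tlettens s (fill (wk A k) t)).
Proof.
have := eta_lettens s (fill k (tlettens (tz _ _) t)).
rewrite fill_fill {2 4}/fill /= vlift_id sub_id_some => <-.
rewrite [in wk A (fill _ _)]/wk ren_fill fill_fill -/(wk A k) {2}/fill /=.
by rewrite vlift_id sub_id_some beta_lettens sub_ren_lift_cons sub_id_some.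
Qed.

Lemma fill_lettop (G : ctx) D A B (t : tm G D (VComp CI)) (u : tm G None (VComp A))
    (k : tm G (Some A) (VComp B)) :
  eqt (fill k (tlettop t u)) (tlettop t (fill k u)).
Proof.
have := eta_lettop t (fill k (tlettop (tz _ _) u)).
rewrite !fill_fill {2 4}/fill /= sub_id_none => <-.
by rewrite beta_lettop.
Qed.

(** This is [fill_lettens] with a second elimination as continuation; that elimination then meets
    the tensor [ttens a b] and reduces. *)
Lemma lettens_lettens (G : ctx) D A B A' B' C (s : tm G D (VComp (CTens A B)))
    (a : tm (A :: G) None A') (b : tm (A :: G) (Some B) (VComp B'))
    (t : tm (A' :: G) (Some B') (VComp C)) :
  eqt (tlettens (tlettens s (ttens a b)) t)
      (tlettens s (sub t (scons a (fun _ x => tvar (vs A x))) (senv1 b))).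
Proof.
have := fill_lettens s (ttens a b) (tlettens (tz _ _) t).
rewrite /fill /= !vlift_id !sub_id_some => ->.
rewrite beta_lettens sub_ren; set s1 := rvcomp _ _; set s2 := scons _ _.
by have -> : s1 = s2 by apply: env_ext; apply: var_case.
Qed.

(** * Substitution in extended contexts *)

Lemma fill_sub (G G' : ctx) D A B (t : tm G (Some B) A) (s : venv G G')
    (u : tm G' D (VComp B)) :
  fill (sub t s (senv1 (tz _ _))) u = sub t s (senv1 u).
Proof. by rewrite /fill sub_sub /= vcomp_idr. Qed.

(** The left side is what eta for functions followed by beta produces from the body of a substituted
    abstraction. When [s] is a [theta_env] and [a] is the inverse theta of the new variable, the
    environment on the right is [theta_env] of the longer context. *)
Lemma inst_ren_sub (G G' : ctx) D D' A B C (t : tm (B :: G) D C) (s : venv G G')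
    (e : senv G' D D') (a : tm (A :: G') None B) :
  inst (ren (sub t (vlift s) (slift B e)) (rlift (fun _ x => vs A x))) a
    = sub t (scons a (fun _ x => wk A (s _ x))) (slift A e).
Proof.
rewrite /inst /vsub sub_ren sub_sub.
have -> : rvcomp (rlift (fun _ x => vs A x)) (scons a (@vid _ _ _))
    = scons a (fun _ x => tvar (vs A x)) by apply: env_ext; apply: var_case.
rewrite vlift_cons scomp_lift_cons; congr (sub _ (scons _ _) _).
  by apply: env_ext => E x; rewrite /wk ren_as_sub.
by case: e => //= E D0 u; rewrite /wk ren_as_sub.
Qed.

(** Whereas [eqt_sub] varies the term substituted into, here the substituted term varies. Both sides
    are beta reducts of one abstraction applied to equal arguments; the next lemma does the same
    with [beta_lettens]. *)
Lemma eqt_sub_scons (G G' : ctx) A B (t : tm (A :: G) None B) (s : venv G G')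
    (a a' : tm G' None A) :
  eqt a a' -> eqt (sub t (scons a s) (senv0 _)) (sub t (scons a' s) (senv0 _)).
Proof.
have E b : eqt (tapp (tlam (sub t (vlift s) (senv0 _))) b) (sub t (scons b s) (senv0 _)).
  by rewrite beta_app /inst /vsub sub_sub vlift_cons vcomp_idr.
by move=> aa'; rewrite -!E aa'.
Qed.

Lemma eqt_sub_scons_senv1 (G G' : ctx) D A B C (t : tm (A :: G) (Some B) (VComp C))
    (s : venv G G') (a a' : tm G' None A) (b b' : tm G' D (VComp B)) :
  eqt a a' -> eqt b b' ->
  eqt (sub t (scons a s) (senv1 b)) (sub t (scons a' s) (senv1 b')).
Proof.
have E c d : eqt (tlettens (ttens c d) (sub t (vlift s) (sid _ _)))
                 (sub t (scons c s) (@senv1 _ _ _ _ D d)).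
  by rewrite beta_lettens sub_sub vlift_cons vcomp_idr.
by move=> aa' bb'; rewrite -!E aa' bb'.
Qed.

(** * Translation against renaming and stoup substitution *)

Section Translate.
Variable R : cty.

(** The case split is forced by [trT], which becomes a type of terms only once [D] and [A] are
    known. *)
Definition trT_ren (G G' : ctx) D A :
    trT R G D A -> renv (gbul R G) (gbul R G') -> trT R G' D A :=
  match D return trT R G D A -> renv (gbul R G) (gbul R G') -> trT R G' D A with
  | None => fun t r => ren t r
  | Some D =>
      match A return trT R G (Some D) A -> renv (gbul R G) (gbul R G') ->
                     trT R G' (Some D) A with
      | VComp B => fun t r => ren t r
      | _ => fun _ _ => tt
      end
  end.

(** Asking [r'] only to agree with [r] on the variables [xbul R x] avoids constructing a renaming of
    translated contexts out of [r], and the condition survives [rlift]. *)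
Lemma tr_ren (G : ctx) D A (t : tm G D A) :
  forall G' (r : renv G G') (r' : renv (gbul R G) (gbul R G')),
  (forall B (x : var G B), r' _ (xbul R x) = xbul R (r _ x)) ->
  tr R (ren t r) = trT_ren (tr R t) r'.
Proof.
have lift (G1 G2 : ctx) C (r : renv G1 G2) (r' : renv (gbul R G1) (gbul R G2)) :
    (forall B (x : var G1 B), r' _ (xbul R x) = xbul R (r _ x)) ->
    forall B (x : var (C :: G1) B),
    @rlift _ _ _ _ (vbul R C) r' _ (xbul R x) = xbul R (rlift r x).
  by move=> rr'; apply: var_case => [|B y] /=; rewrite ?rr'.
elim: t => {G D A}
  [||||||||G [D|]|G [D|]|G [D|]|G [D|]|G [D|]|G [D|]||G [D|]||G [D|]|G [D|]
  |G [D|]|G [D|]|G [D|]|G [D|]|G [D|]||G [D|]] *.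
all: rewrite /= ?ren_fill /=.
all: repeat match goal with
  | IH : forall _ _ _, _ -> tr _ _ = _ |- _ =>
      (erewrite IH; last by (eassumption || (apply: lift; eassumption))); clear IH
  end.
all: rewrite /=.
all: try done.
(* The variable case is the one that remains; it is the assumption on [r']. *)
by match goal with H : forall _ _, _ = _ |- _ => rewrite H end.
Qed.

Lemma ctr_wk (G : ctx) A B C (t : tm G (Some A) (VComp B)) :
  ctr R (wk C t) = wk (vbul R C) (ctr R t).
Proof.
exact: (@tr_ren _ _ _ t _ (fun _ x => vs C x) (fun _ x => vs (vbul R C) x)).
Qed.

(** A motive for induction over all terms: matching on the indices makes the claim trivial except
    for computation terms with a stoup. *)
Definition tr_fill_spec (G : ctx) D A : tm G D A -> Prop :=
  match D with
  | None => fun _ => True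
  | Some B =>
      match A return tm G (Some B) A -> Prop with
      | VComp C => fun t => forall E (k : tm G (Some E) (VComp B)),
          eqt (ctr R (fill t k)) (fill (ctr R k) (ctr R t))
      | _ => fun _ => True
      end
  end.

(** The formers [tcstar], [tcpair] and [tclam] translate to eliminators of the stoup variable, and
    [ctr R k] moves past these by [eta_abort] or a commuting conversion. Apart from [tz], the other
    relevant formers translate to a [fill], where associativity leaves the induction hypothesis. *)
Lemma tr_fill (G : ctx) D A (t : tm G D A) : tr_fill_spec t.
Proof.
elim: t => {G D A}
  [||||||||G [D|]|G [D|]|G [D|]|G [D|]|G [D|]|G [D|]||G [D|]||G [D|]|G [D|]
  |G [D|]|G [D|]|G [D|]|G [D|]|G [D|]||G [D|]] //.
all: try by move=> *; exact: I.
all: rewrite /tr_fill_spec /ctr.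
- by move=> G A E k; rewrite /= fill_tz.
- move=> E k; rewrite /=.
  by rewrite (eta_abort (tz _ _) (fill (tr R k) (tabort _ (tz _ _)))) fill_tz.
- move=> A B t IHt u IHu E k; apply: eqt_trans (eqt_sym (fill_case _ _ _ _)).
  exact: cong_case (eqt_refl _) (IHt _ _) (IHu _ _).
3: { move=> A B t IHt E k; rewrite fill_clam.
     apply: eqt_trans (eqt_sym (fill_lettens _ _ _)).
     apply: cong_lettens (eqt_refl _) _.
     by rewrite -[wk _ (tr R k)](ctr_wk A k); apply: IHt. }
all: intros; rewrite [X in tr R X]/fill /= ?vlift_id ?sub_id_none ?sub_id_some.
all: rewrite -fill_fill; apply: fill_proper; last exact: eqt_refl.
all: match goal with IH : _ |- _ => exact: IH end.
Qed.

Lemma ctr_fill (G : ctx) A B C (t : tm G (Some B) (VComp C))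
    (k : tm G (Some A) (VComp B)) :
  eqt (ctr R (fill t k)) (fill (ctr R k) (ctr R t)).
Proof. exact: (tr_fill t). Qed.

(* The dual of the stoup, the empty stoup counting as the unit [CI]. *)
Definition answer (D : stoup) : cty := if D is Some A then ccirc R A else R.

(** * Uniform translation of computation terms *)

Definition cps (G : ctx) D B :
    tm G D (VComp B) -> tm (gbul R G) (Some (ccirc R B)) (VComp (answer D)) :=
  match D return tm G D (VComp B) ->
    tm (gbul R G) (Some (ccirc R B)) (VComp (answer D)) with
  | None => fun t => tlapp (vtr R t) (tz _ _)
  | Some _ => fun t => ctr R t
  end.

Definition cps2 (G : ctx) D B (t : tm G D (VComp B)) :
    tm (gbul R (gbul R G)) (Some (ccirc R (answer D)))
       (VComp (ccirc R (ccirc R B))) :=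
  ctr R (cps t).

Notation vtr2 t := (vtr R (vtr R t)).
Notation ctr2 t := (ctr R (ctr R t)).

Lemma cps2_none (G : ctx) B (t : tm G None (VComp B)) :
  cps2 t = tlapp (vtr2 t) (tz _ _).
Proof. by []. Qed.

(** The equations are Leibniz equalities because [cps2_body] rewrites with them underneath a second
    translation. *)
Definition has_body (G : ctx) D B (t : tm G D (VComp B)) :
    tm (gbul R G) (Some (ccirc R B)) (VComp (answer D)) -> Prop :=
  match D return tm G D (VComp B) ->
    tm (gbul R G) (Some (ccirc R B)) (VComp (answer D)) -> Prop with
  | None => fun t b => vtr R t = tllam b
  | Some _ => fun t b => ctr R t = b
  end t.

Lemma cps2_body (G : ctx) D B (t : tm G D (VComp B)) b :
  has_body t b -> eqt (cps2 t) (ctr R b).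
Proof.
case: D t b => [D|] t b; first by rewrite /cps2 /= => ->.
by rewrite cps2_none /= => ->; rewrite /vtr /= beta_lapp fill_tz.
Qed.

(** The common shape of many clauses of the translation: a new continuation [k] is handed to the
    translation of the main premise. *)
Definition plug (G : ctx) D B E (t : tm G D (VComp B)) :
    tm (gbul R G) (Some E) (VComp (ccirc R B)) ->
    tm (gbul R G) (Some E) (VComp (answer D)) :=
  match D return tm G D (VComp B) ->
    tm (gbul R G) (Some E) (VComp (ccirc R B)) ->
    tm (gbul R G) (Some E) (VComp (answer D)) with
  | None => fun t k => tlapp (vtr R t) k
  | Some _ => fun t k => fill (ctr R t) k
  end t.

(** The two reversals of order cancel: the continuation handed to [t] ends up around [cps2 t], so it
    remains to read off [ctr R k]. With a stoup this is [ctr_fill]; without one it holds by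
    computation. *)
Lemma cps2_plug (G : ctx) D B C (t : tm G D (VComp B)) (u : tm G D (VComp C))
    (k : tm (gbul R G) (Some (ccirc R C)) (VComp (ccirc R B))) :
  has_body u (plug t k) -> eqt (cps2 u) (fill (ctr R k) (cps2 t)).
Proof.
move/cps2_body->.
by case: D t u => [D|] t u; [exact: ctr_fill | exact: eqt_refl].
Qed.

(** * Double translation of each computation former *)

Lemma cps2_cpair (G : ctx) D A B (t : tm G D (VComp A)) (u : tm G D (VComp B)) :
  eqt (cps2 (tcpair t u)) (tcpair (cps2 t) (cps2 u)).
Proof.
rewrite (@cps2_body _ _ _ (tcpair t u) (tcase (tz _ _) (cps t) (cps u)));
  last by case: D t u => [D|].
by case: D t u => [D|].
Qed.

Lemma cps2_cfst (G : ctx) D A B (t : tm G D (VComp (CProd A B))) :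
  eqt (cps2 (tcfst t)) (tcfst (cps2 t)).
Proof.
rewrite (@cps2_plug _ _ _ _ t (tcfst t) (tinl _ (tz _ _)));
  last by case: D t => [D|].
by [].
Qed.

Lemma cps2_csnd (G : ctx) D A B (t : tm G D (VComp (CProd A B))) :
  eqt (cps2 (tcsnd t)) (tcsnd (cps2 t)).
Proof.
rewrite (@cps2_plug _ _ _ _ t (tcsnd t) (tinr _ (tz _ _)));
  last by case: D t => [D|].
by [].
Qed.

Lemma cps2_clam (G : ctx) D A B (t : tm (A :: G) D (VComp B)) :
  eqt (cps2 (tclam t)) (tclam (cps2 t)).
Proof.
rewrite (@cps2_body _ _ _ (tclam t) (tlettens (tz _ _) (cps t)));
  last by case: D t => [D|].
by case: D t => [D|].
Qed.

Lemma cps2_capp (G : ctx) D A B (s : tm G D (VComp (CArr A B))) (t : tm G None A) :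
  eqt (cps2 (tcapp s t)) (tcapp (cps2 s) (vtr2 t)).
Proof.
rewrite (@cps2_plug _ _ _ _ s (tcapp s t) (ttens (vtr R t) (tz _ _)));
  last by case: D s => [D|].
by rewrite /fill /= sub_id_none.
Qed.

Lemma cps2_top (G : ctx) :
  eqt (cps2 (ttop G)) (tz _ _).
Proof.
rewrite (@cps2_body _ _ _ (ttop G) (tz _ _)); last by [].
by [].
Qed.

Lemma cps2_lettop (G : ctx) D A (t : tm G D (VComp CI)) (u : tm G None (VComp A)) :
  eqt (cps2 (tlettop t u)) (tlapp (vtr2 u) (cps2 t)).
Proof.
rewrite (@cps2_plug _ _ _ _ t (tlettop t u) (tlapp (vtr R u) (tz _ _)));
  last by case: D t => [D|].
by rewrite /fill /= sub_id_none.
Qed.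

Lemma cps2_bang (G : ctx) A (t : tm G None A) :
  eqt (cps2 (tbang t)) (ttens (vtr2 t) (tz _ _)).
Proof.
rewrite (@cps2_body _ _ _ (tbang t) (tcapp (tz _ _) (vtr R t))); last by [].
by [].
Qed.

(** The type [CBang A] becomes a function type into [R] and then a tensor with [ccirc R R], so
    [tletbang] comes back as [tlettens], whose stoup variable is fed to the translated body. *)
Lemma cps2_letbang (G : ctx) D A B (t : tm G D (VComp (CBang A)))
    (u : tm (A :: G) None (VComp B)) :
  eqt (cps2 (tletbang t u)) (tlettens (cps2 t) (tlapp (vtr2 u) (tz _ _))).
Proof.
rewrite (@cps2_plug _ _ _ _ t (tletbang t u) (tclam (tlapp (vtr R u) (tz _ _))));
  last by case: D t => [D|].
by rewrite /fill /= vlift_id sub_id_none.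
Qed.

Lemma cps2_tens (G : ctx) D A B (t : tm G None A) (u : tm G D (VComp B)) :
  eqt (cps2 (ttens t u)) (ttens (vtr2 t) (cps2 u)).
Proof.
rewrite (@cps2_plug _ _ _ _ u (ttens t u) (tcapp (tz _ _) (vtr R t)));
  last by case: D u => [D|].
by rewrite /fill /= sub_id_none.
Qed.

Lemma cps2_lettens (G : ctx) D A B C (s : tm G D (VComp (CTens A B)))
    (t : tm (A :: G) (Some B) (VComp C)) :
  eqt (cps2 (tlettens s t)) (tlettens (cps2 s) (ctr2 t)).
Proof.
rewrite (@cps2_plug _ _ _ _ s (tlettens s t) (tclam (ctr R t)));
  last by case: D s => [D|].
by rewrite /fill /= vlift_id sub_id_some.
Qed.

Lemma cps2_abort (G : ctx) D A (t : tm G D (VComp CZero)) :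
  eqt (cps2 (tabort A t)) (tabort _ (cps2 t)).
Proof.
rewrite (@cps2_plug _ _ _ _ t (tabort A t) (tcstar _ _));
  last by case: D t => [D|].
by [].
Qed.

Lemma cps2_inl (G : ctx) D A B (t : tm G D (VComp A)) :
  eqt (cps2 (tinl B t)) (tinl _ (cps2 t)).
Proof.
rewrite (@cps2_plug _ _ _ _ t (tinl B t) (tcfst (tz _ _)));
  last by case: D t => [D|].
by [].
Qed.

Lemma cps2_inr (G : ctx) D A B (t : tm G D (VComp B)) :
  eqt (cps2 (tinr A t)) (tinr _ (cps2 t)).
Proof.
rewrite (@cps2_plug _ _ _ _ t (tinr A t) (tcsnd (tz _ _)));
  last by case: D t => [D|].
by [].
Qed.

Lemma cps2_case (G : ctx) D A B C (s : tm G D (VComp (CSum A B)))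
    (t : tm G (Some A) (VComp C)) (u : tm G (Some B) (VComp C)) :
  eqt (cps2 (tcase s t u)) (tcase (cps2 s) (ctr2 t) (ctr2 u)).
Proof.
rewrite (@cps2_plug _ _ _ _ s (tcase s t u) (tcpair (ctr R t) (ctr R u)));
  last by case: D s => [D|].
by rewrite /fill /= !sub_id_some.
Qed.

Lemma cps2_lapp (G : ctx) D A B (s : tm G None (VLin A B)) (t : tm G D (VComp A)) :
  eqt (cps2 (tlapp s t)) (tlapp (vtr2 s) (cps2 t)).
Proof.
rewrite (@cps2_plug _ _ _ _ t (tlapp s t) (tlapp (vtr R s) (tz _ _)));
  last by case: D t => [D|].
by rewrite /fill /= sub_id_none.
Qed.

(** * Computation rules for theta and its inverses *)

Section Theta.
Variables (HR : const_or_I R).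
Variable vinv : forall A, tm [::] None (VArr A (vbul R (vbul R A))).
Variable cinv : forall A, tm [::] None (VLin A (ccirc R (ccirc R A))).
Hypothesis hinv : theta_inverses HR vinv cinv.

Notation th A a := (tapp (wk0 _ (theta HR vinv cinv A)) a).
Notation thV A a := (tapp (wk0 _ (vinv A)) a).
Notation cth A a := (tlapp (wk0 _ (ctheta HR vinv cinv A)) a).
Notation cthV A a := (tlapp (wk0 _ (cinv A)) a).
Notation topR := (ccast (esym (ccirc_R HR)) (ttop _)).

Lemma eqt_wk0 (G : ctx) A (t u : tm [::] None A) : eqt t u -> eqt (wk0 G t) (wk0 G u).
Proof. by move=> tu; rewrite /wk0 !ren_as_sub; apply: eqt_sub. Qed.

(** The hypothesis [hinv] relates closed abstractions; weakening both and applying them to [a] gives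
    the equation at an arbitrary argument after beta. The next three lemmas are obtained
    likewise. *)
Lemma thK (G : ctx) A (a : tm G None (vbul R (vbul R A))) : eqt (thV A (th A a)) a.
Proof.
have := cong_app (eqt_wk0 G (hinv.1 A).1) (eqt_refl a).
by rewrite !beta0 /= !sub_wk0.
Qed.

Lemma thVK (G : ctx) A (a : tm G None A) : eqt (th A (thV A a)) a.
Proof.
have := cong_app (eqt_wk0 G (hinv.1 A).2) (eqt_refl a).
by rewrite !beta0 /= !sub_wk0.
Qed.

Lemma cthVK (G : ctx) D A (a : tm G D (VComp A)) : eqt (cth A (cthV A a)) a.
Proof.
have := cong_lapp (eqt_wk0 G (hinv.2 A).2) (eqt_refl a).
by rewrite !lbeta0 /= !sub_closed.
Qed.

Lemma cthK (G : ctx) D A (a : tm G D (VComp (ccirc R (ccirc R A)))) :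
  eqt (cthV A (cth A a)) a.
Proof.
have := cong_lapp (eqt_wk0 G (hinv.2 A).1) (eqt_refl a).
by rewrite !lbeta0 /= !sub_closed.
Qed.

Ltac compute_theta :=
  rewrite /= ?beta0 ?lbeta0 /= ?sub_wk0 ?sub_closed ?sub_cast /=.

Lemma th_prod (G : ctx) A B (p : tm G None (vbul R (vbul R (VProd A B)))) :
  eqt (th (VProd A B) p) (tpair (th A (tfst p)) (th B (tsnd p))).
Proof. by compute_theta. Qed.

Lemma th_arr (G : ctx) A B (f : tm G None (vbul R (vbul R (VArr A B)))) a :
  eqt (tapp (th (VArr A B) f) a) (th B (tapp f (thV A a))).
Proof.
by compute_theta; rewrite beta_app /inst /vsub /= !sub_wk0 sub_wk_cons sub_id_none.
Qed.

Lemma th_comp (G : ctx) A (h : tm G None (vbul R (vbul R (VComp A)))) :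
  eqt (th (VComp A) h) (cth A (tlapp h topR)).
Proof. by compute_theta. Qed.

Lemma th_lin (G : ctx) D A B (h : tm G None (vbul R (vbul R (VLin A B))))
    (a : tm G D (VComp A)) :
  eqt (tlapp (th (VLin A B) h) a) (cth B (tlapp h (cthV A a))).
Proof.
by compute_theta; rewrite beta_lapp /fill /= !sub_wk0 sub_id_none.
Qed.

Lemma cth_prod (G : ctx) D A B (p : tm G D (VComp (ccirc R (ccirc R (CProd A B))))) :
  eqt (cth (CProd A B) p) (tcpair (cth A (tcfst p)) (cth B (tcsnd p))).
Proof. by compute_theta. Qed.

Lemma cth_arr (G : ctx) D A B (f : tm G D (VComp (ccirc R (ccirc R (CArr A B))))) a :
  eqt (tcapp (cth (CArr A B) f) a) (cth B (tcapp f (thV A a))).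
Proof.
by compute_theta; rewrite beta_capp /inst /vsub /= !sub_wk0 sub_wk_cons sub_id.
Qed.

Lemma cth_I (G : ctx) D (a : tm G D (VComp (ccirc R (ccirc R CI)))) :
  eqt (cth CI a) (ccast (ccirc_R HR) a).
Proof. by compute_theta. Qed.

Lemma cth_bang (G : ctx) A (a : tm G None (vbul R (vbul R A))) :
  eqt (cth (CBang A) (ttens a topR)) (tbang (th A a)).
Proof.
compute_theta; rewrite beta_lettens; compute_theta.
by rewrite castKV beta_lettop.
Qed.

Lemma cth_tens (G : ctx) D A B (a : tm G None (vbul R (vbul R A)))
    (b : tm G D (VComp (ccirc R (ccirc R B)))) :
  eqt (cth (CTens A B) (ttens a b)) (ttens (th A a) (cth B b)).
Proof. by compute_theta; rewrite beta_lettens; compute_theta. Qed.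

Lemma cth_inl (G : ctx) D A B (a : tm G D (VComp (ccirc R (ccirc R A)))) :
  eqt (cth (CSum A B) (tinl (ccirc R (ccirc R B)) a)) (tinl B (cth A a)).
Proof. by compute_theta; rewrite beta_inl /fill; compute_theta. Qed.

Lemma cth_inr (G : ctx) D A B (b : tm G D (VComp (ccirc R (ccirc R B)))) :
  eqt (cth (CSum A B) (tinr (ccirc R (ccirc R A)) b)) (tinr A (cth B b)).
Proof. by compute_theta; rewrite beta_inr /fill; compute_theta. Qed.

(** * Round trips *)

(** This fills the stoup of [cps2 t] on the way back. When [t] has no stoup, the type to inhabit is
    [ccirc R R], which equals [CI], hence the unit. *)
Definition stoup_inv (G : ctx) D : tm G D (VComp (ccirc R (answer D))) :=
  match D return tm G D (VComp (ccirc R (answer D))) with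
  | None => topR
  | Some A => cthV A (tz G A)
  end.

Definition vround (G : ctx) A (t : tm G None A) : tm G None (vbul R (vbul R A)) :=
  sub (vtr2 t) (theta_env vinv G) (senv0 _).

Definition cround (G : ctx) D B (t : tm G D (VComp B)) :
    tm G D (VComp (ccirc R (ccirc R B))) :=
  sub (cps2 t) (theta_env vinv G) (senv1 (stoup_inv G D)).

Definition roundtrip (G : ctx) D A : tm G D A -> Prop :=
  match D return tm G D A -> Prop with
  | None => fun t => eqt t (th A (vround t))
  | Some D =>
      match A return tm G (Some D) A -> Prop with
      | VComp B => fun t => eqt t (cth B (cround t))
      | _ => fun _ => True
      end
  end.

(** Without a stoup, [th_comp] applies the double translation to [topR], exactly what [stoup_inv]
    supplies, so both kinds of computation terms obey one equation. *)
Lemma roundtrip_comp (G : ctx) D B (t : tm G D (VComp B)) :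
  roundtrip t <-> eqt t (cth B (cround t)).
Proof. by case: D t => [D|] t //=; rewrite th_comp. Qed.

Lemma theta_env_xbul (G : ctx) A (x : var G A) :
  theta_env vinv G (xbul R (xbul R x)) = thV A (tvar x).
Proof. by elim: x => //= {}A B {}G x ->; rewrite /wk /= ren_wk0. Qed.

Lemma wk_stoup_inv (G : ctx) D A : wk A (stoup_inv G D) = stoup_inv (A :: G) D.
Proof.
case: D => [D|] /=; rewrite /wk /=; first by rewrite ren_wk0.
by rewrite ren_as_sub sub_cast.
Qed.

(** * Theta and the eliminators *)

Lemma cth_lettens (G : ctx) D A B C (s : tm G D (VComp (CTens A B))) t :
  eqt (cth C (tlettens s t)) (tlettens s (cth C t)).
Proof.
have := fill_lettens s t (cth C (tz _ _)).
by rewrite /fill /= /wk !ren_wk0 !sub_wk0.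
Qed.

Lemma cth_case (G : ctx) D A B C (s : tm G D (VComp (CSum A B))) t u :
  eqt (cth C (tcase s t u)) (tcase s (cth C t) (cth C u)).
Proof.
have := fill_case s t u (cth C (tz _ _)).
by rewrite /fill /= !sub_wk0.
Qed.

(** An instance of [eta_lettop], whose continuation casts its stoup variable back to [ccirc R R];
    the two casts cancel. *)
Lemma lettop_cth (G : ctx) D A (t : tm G D (VComp (ccirc R R))) h :
  eqt (tlettop (ccast (ccirc_R HR) t) (cth A (tlapp h topR))) (cth A (tlapp h t)).
Proof.
have := eta_lettop (ccast (ccirc_R HR) t)
  (cth A (tlapp h (ccast (esym (ccirc_R HR)) (tz _ _)))).
by rewrite /fill /= !sub_wk0 !sub_id_none !sub_cast /= castK.
Qed.

(** Theta at [CBang A] takes a tensor apart, consumes its unit component and rebuilds a banged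
    value. Commuting conversions bring that value up to [tletbang], which reduces and leaves the
    hypothesis on [u]. *)
Lemma letbang_cth (G : ctx) D A B (s : tm G D (VComp (ccirc R (ccirc R (CBang A)))))
    (u : tm (A :: G) None (VComp B)) h :
  eqt (sub u (scons (th A (tvar (vz _ _))) (fun _ x => tvar (vs _ x))) (senv0 _))
      (cth B (tlapp h topR)) ->
  eqt (tletbang (cth (CBang A) s) u) (cth B (tlettens s (tlapp h (tz _ _)))).
Proof.
move=> uh; rewrite cth_lettens; compute_theta.
have := fill_lettens s
  (tlettop (ccast (ccirc_R HR) (tz _ _)) (tbang (th A (tvar (vz _ _)))))
  (tletbang (tz _ _) u).
rewrite {1}/fill /= vlift_id sub_id_none => ->; apply: cong_lettens => //.
rewrite fill_lettop -lettop_cth; apply: cong_lettop => //.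
rewrite /fill /= vlift_id sub_id_none beta_letbang /inst /vsub sub_ren.
apply: eqt_trans uh; set s1 := rvcomp _ _; set s2 := scons _ _.
by have -> : s1 = s2 by apply: env_ext; apply: var_case.
Qed.

Lemma lettens_cth (G : ctx) D A B C
    (s : tm G D (VComp (ccirc R (ccirc R (CTens A B)))))
    (t : tm (A :: G) (Some B) (VComp C)) t' :
  eqt (sub t (scons (th A (tvar (vz _ _))) (fun _ x => tvar (vs _ x)))
         (senv1 (cth B (tz _ _)))) (cth C t') ->
  eqt (tlettens (cth (CTens A B) s) t) (cth C (tlettens s t')).
Proof.
by move=> tt'; rewrite cth_lettens; compute_theta; rewrite lettens_lettens tt'.
Qed.

Lemma case_cth (G : ctx) D A B C (s : tm G D (VComp (ccirc R (ccirc R (CSum A B)))))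
    (t : tm G (Some A) (VComp C)) (u : tm G (Some B) (VComp C)) t' u' :
  eqt (fill t (cth A (tz _ _))) (cth C t') ->
  eqt (fill u (cth B (tz _ _))) (cth C u') ->
  eqt (tcase (cth (CSum A B) s) t u) (cth C (tcase s t' u')).
Proof.
move=> tt' uu'; rewrite cth_case; compute_theta.
have := fill_case s (tinl B (cth A (tz _ _))) (tinr A (cth B (tz _ _)))
  (tcase (tz _ _) t u).
rewrite /fill /= !sub_id_some => ->.
by rewrite beta_inl beta_inr tt' uu'.
Qed.

Lemma abort_cth (G : ctx) D A (t : tm G D (VComp (ccirc R (ccirc R CZero)))) :
  eqt (tabort A (cth CZero t)) (cth A (tabort _ t)).
Proof.
compute_theta; rewrite (eta_abort t (cth A (tabort _ (tz _ _)))).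
by rewrite /fill /= sub_wk0.
Qed.

(** Intended for [a] equal to theta of the new variable: the head entry is then an inverse applied
    to a theta and cancels by [thK]. *)
Lemma theta_env_cons_comp (G : ctx) A B (a : tm (B :: G) None A) :
  vcomp (theta_env vinv (A :: G)) (scons a (fun _ x => tvar (vs B x)))
    = scons (thV A a) (fun _ x => wk B (theta_env vinv G x)).
Proof.
rewrite [theta_env]lock /= -lock vcomp_cons /= sub_wk0; congr (scons _ _).
by apply: env_ext => C x; rewrite /vcomp sub_wk_cons /wk ren_as_sub.
Qed.

(** In the branches of a case the stoup variable arrives through theta, which cancels against the
    inverse inserted by [cround]. *)
Lemma fill_cth_roundtrip (G : ctx) A B (t : tm G (Some A) (VComp B)) :
  eqt t (cth B (cround t)) ->
  eqt (fill t (cth A (tz _ _)))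
      (cth B (sub (ctr2 t) (theta_env vinv G) (senv1 (tz _ _)))).
Proof.
move=> E; rewrite {1}E /fill /= sub_wk0; apply: cong_lapp => //.
rewrite /cround sub_sub vcomp_idr /= sub_wk0.
by rewrite -(fill_sub (cps2 t)) cthK fill_tz.
Qed.

(** * Induction over terms *)

Lemma roundtrip_all (G : ctx) D A (t : tm G D A) : roundtrip t.
Proof.
elim: t => {G D A}.
- by move=> G A x; rewrite /= /vround /= theta_env_xbul thVK.
- by move=> G; apply: eqt_trans (eta_star _) (eqt_sym (eta_star _)).
- move=> G A B t IHt u IHu; rewrite /= th_prod /vround /= beta_fst beta_snd.
  exact: cong_pair.
- move=> G A B t IHt.
  by apply: eqt_trans (cong_fst IHt) _; rewrite th_prod beta_fst.
- move=> G A B t IHt.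
  by apply: eqt_trans (cong_snd IHt) _; rewrite th_prod beta_snd.
(* Eta-expanding the right side turns it into an abstraction, and its body computes by [th_arr]. *)
- move=> G A B t IHt; rewrite /roundtrip -(eta_lam (th _ _)).
  apply: cong_lam; apply: eqt_trans IHt _.
  rewrite wk_app wk_wk0 th_arr beta_app.
  by rewrite (inst_ren_sub _ _ (senv0 _)).
- move=> G A B t IHt u IHu.
  (* The inverse that [th_arr] places on the argument cancels the theta given by [IHu]. *)
  by apply: eqt_trans (cong_app IHt IHu) _; rewrite th_arr thK.
- move=> G A; apply/roundtrip_comp; exact: eqt_sym (cthVK _).
- move=> G D; apply/roundtrip_comp.
  exact: eqt_trans (eta_cstar _) (eqt_sym (eta_cstar _)).
- move=> G D A B t /roundtrip_comp IHt u /roundtrip_comp IHu; apply/roundtrip_comp.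
  rewrite /cround (eqt_sub (cps2_cpair t u)) /= cth_prod beta_cfst beta_csnd.
  exact: cong_cpair.
- move=> G D A B t /roundtrip_comp IHt; apply/roundtrip_comp.
  by rewrite /cround (eqt_sub (cps2_cfst t)) {1}IHt cth_prod beta_cfst.
- move=> G D A B t /roundtrip_comp IHt; apply/roundtrip_comp.
  by rewrite /cround (eqt_sub (cps2_csnd t)) {1}IHt cth_prod beta_csnd.
- move=> G D A B t /roundtrip_comp IHt; apply/roundtrip_comp.
  rewrite /cround (eqt_sub (cps2_clam t)) -(eta_clam (cth _ _)).
  apply: cong_clam; apply: eqt_trans IHt _.
  rewrite wk_lapp wk_wk0 cth_arr beta_capp.
  by rewrite (inst_ren_sub _ _ (senv1 _)) /= wk_stoup_inv.
- move=> G D A B s /roundtrip_comp IHs t IHt; apply/roundtrip_comp.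
  rewrite /cround (eqt_sub (cps2_capp s t)) {1}IHs {1}IHt cth_arr thK.
  exact: eqt_refl.
- move=> G; apply/roundtrip_comp.
  by rewrite /cround (eqt_sub (cps2_top G)) cth_I /= castKV.
- move=> G D A t /roundtrip_comp IHt u /roundtrip_comp IHu; apply/roundtrip_comp.
  rewrite /cround (eqt_sub (cps2_lettop t u)) {1}IHt {1}IHu cth_I lettop_cth.
  exact: eqt_refl.
- move=> G A t IHt; apply/roundtrip_comp.
  rewrite /cround (eqt_sub (cps2_bang t)) /= cth_bang.
  exact: cong_bang.
- move=> G D A B t /roundtrip_comp IHt u /roundtrip_comp IHu; apply/roundtrip_comp.
  rewrite /cround (eqt_sub (cps2_letbang t u)) {1}IHt.
  (* The body is replaced by its round trip, so that theta of the bound variable lands on the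
     inverse stored in [theta_env]. *)
  apply: letbang_cth; apply: eqt_trans (eqt_sub IHu _ _) _.
  rewrite /= sub_wk0; apply: cong_lapp => //; rewrite sub_cast /=.
  apply: cong_lapp => //; rewrite /vround sub_sub theta_env_cons_comp.
  exact: eqt_sub_scons (thK _).
- move=> G D A B t IHt u /roundtrip_comp IHu; apply/roundtrip_comp.
  rewrite /cround (eqt_sub (cps2_tens t u)) {1}IHt {1}IHu /= cth_tens.
  exact: eqt_refl.
- move=> G D A B C s /roundtrip_comp IHs t /roundtrip_comp IHt; apply/roundtrip_comp.
  rewrite /cround (eqt_sub (cps2_lettens s t)) {1}IHs.
  apply: lettens_cth; apply: eqt_trans (eqt_sub IHt _ _) _.
  rewrite /= sub_wk0; apply: cong_lapp => //.
  rewrite /cround sub_sub theta_env_cons_comp /= sub_wk0.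
  exact: eqt_sub_scons_senv1 (thK _) (cthK _).
- move=> G D A t /roundtrip_comp IHt; apply/roundtrip_comp.
  rewrite /cround (eqt_sub (cps2_abort A t)) {1}IHt abort_cth.
  exact: eqt_refl.
- move=> G D A B t /roundtrip_comp IHt; apply/roundtrip_comp.
  by rewrite /cround (eqt_sub (cps2_inl B t)) {1}IHt /= cth_inl.
- move=> G D A B t /roundtrip_comp IHt; apply/roundtrip_comp.
  by rewrite /cround (eqt_sub (cps2_inr A t)) {1}IHt /= cth_inr.
- move=> G D A B C s /roundtrip_comp IHs t /roundtrip_comp IHt u /roundtrip_comp IHu.
  apply/roundtrip_comp; rewrite /cround (eqt_sub (cps2_case s t u)) {1}IHs.
  by apply: case_cth; apply: fill_cth_roundtrip.
- move=> G A B t IHt; rewrite /roundtrip -(eta_llam (th _ _)).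
  apply: cong_llam; apply: eqt_trans IHt _.
  by rewrite th_lin /vround /= beta_lapp fill_sub.
- move=> G D A B s IHs t /roundtrip_comp IHt; apply/roundtrip_comp.
  rewrite /cround (eqt_sub (cps2_lapp s t)) {1}IHs {1}IHt th_lin cthK.
  exact: eqt_refl.
Qed.
End Theta.
End Translate.
End SelfTranslation.

Theorem theorem5p4 (VK : Type) (CK : eqType) (R : cty VK CK)
    (hR : const_or_I R)
    (vinv : forall A, tm [::] None (VArr A (vbul R (vbul R A))))
    (cinv : forall A, tm [::] None (VLin A (ccirc R (ccirc R A))))
    (hinv : theta_inverses hR vinv cinv) :
  (forall (G : ctx VK CK) (A : vty VK CK) (t : tm G None A),
     eqt t
       (vsub (tapp (wk0 _ (theta hR vinv cinv A)) (vtr R (vtr R t)))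
             (theta_env vinv G))) /\
  (forall (G : ctx VK CK) (A B : cty VK CK) (t : tm G (Some A) (VComp B)),
     eqt t
       (vsub (fill (tlapp (wk0 _ (ctheta hR vinv cinv B)) (ctr R (ctr R t)))
                   (tlapp (wk0 _ (cinv A)) (tz _ A)))
             (theta_env vinv G))).
Proof.
split=> [G A t | G A B t]; have := roundtrip_all hinv t.
  by rewrite /vsub /= sub_wk0.
rewrite /vsub sub_fill /= !sub_wk0 /fill /= sub_wk0.
(* The successive substitutions for context and stoup merge into the simultaneous one used by
   [cround]. *)
by rewrite -[sub (sub _ _ _) _ _]/(fill _ _) fill_sub.
Qed.
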